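(* Let $H$ and $U$ be Hilbert spaces, let $A:D(A)\subset H\to H$ be a densely defined closed linear operator such that $A$ and its adjoint $A^\star$ are dissipative, and let $B\in\mathcal{L}(U,H)$ with adjoint $B^\star$. Let $d:\mathbb{R}_+\to\mathbb{R}$ be a continuous function for which there exist positive constants $d_0,d_1$ with $d_0\le d(t)\le d_1$ for all $t\ge 0$. Suppose that the origin of the system $$\frac{d}{dt}v=(A-d_0BB^\star)v,\qquad v(0)=v_0,$$ is globally exponentially stable. Then, for any initial condition $v_0\in H$, the solution of $$\frac{d}{dt}v=(A-d(t)BB^\star)v,\qquad v(0)=v_0,$$ converges exponentially to $0$; that is, there exist constants $K,\beta>0$ such that for every $v_0\in H$ the solution satisfies $\|v(t)\|_H\le Ke^{-\beta t}\|v_0\|_H$ for all $t\ge 0$.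
   Context: Under the stated assumptions, for each $t\geq 0$ the operator $A_d(t):=A-d(t)BB^\star$ with domain $D(A)$ generates a strongly continuous semigroup of contractions, and there is an evolution family $(W(\theta,\tau))_{\theta\ge\tau\ge0}$ of bounded operators on $H$ solving $\frac{d}{dt}v=A_d(t)v$, $v(\tau)=v_\tau$. For $v_0\in H$, the solution with $\tau=0$ is $v(t)=W(t,0)v_0$ (mild solution); it is a strong solution when $v_0\in D(A)$. Global exponential stability of the origin of $\frac{d}{dt}v=(A-d_0BB^\star)v$ means that there exist $K_0,\beta_0>0$ such that $\|e^{t(A-d_0BB^\star)}v_0\|_H\le K_0e^{-\beta_0t}\|v_0\|_H$ for all $v_0\in H$ and $t\ge0$. *)

(* Defs.v *)
From Stdlib Require Import Reals ClassicalEpsilon.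
From Coquelicot Require Import Coquelicot.

Local Open Scope R_scope.

(* "Hilbert space" without further precision allows both real and complex
   scalars, so everything is parametrized by the choice of scalar field. *)
Inductive scalar_field : Set := Reals | Complexes.

Definition scalars (k : scalar_field) : AbsRing :=
  match k with Reals => R_AbsRing | Complexes => C_AbsRing end.

Definition of_R {k : scalar_field} : R -> scalars k :=
  match k with Reals => fun r => r | Complexes => RtoC end.

Definition re {k : scalar_field} : scalars k -> R :=
  match k with Reals => fun r => r | Complexes => Re end.

Definition conj {k : scalar_field} : scalars k -> scalars k :=
  match k with Reals => fun r => r | Complexes => Cconj end.

(* The inner product is linear in its first argument. Positive definiteness
   follows from [ip_norm] and the axioms of a norm. *)
Record Hilbert (k : scalar_field) : Type := mkHilbert {
  hilbert_space :> CompleteNormedModule (scalars k);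
  ip : hilbert_space -> hilbert_space -> scalars k;
  ip_plus : forall x y z, ip (plus x y) z = plus (ip x z) (ip y z);
  ip_scal : forall a x z, ip (scal a x) z = mult a (ip x z);
  ip_conj : forall x y, ip y x = conj (ip x y);
  ip_norm : forall x, ip x x = of_R (norm x ^ 2)
}.
Arguments ip {k} _ _ _.

(** Restriction of scalars to R; Coquelicot's Riemann integral is defined for
    functions with values in a normed module over R. *)

Section RestrictScalars.

Variables (k : scalar_field) (V : CompleteNormedModule (scalars k)).

Lemma of_R_one : @of_R k 1 = one.
Proof. now destruct k. Qed.

Lemma of_R_plus (a b : R) : @of_R k (a + b) = plus (of_R a) (of_R b).
Proof. destruct k; [easy | apply RtoC_plus]. Qed.

Lemma of_R_mult (a b : R) : @of_R k (a * b) = mult (of_R a) (of_R b).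
Proof. destruct k; [easy | apply RtoC_mult]. Qed.

Lemma abs_of_R (a : R) : abs (@of_R k a) = Rabs a.
Proof. destruct k; [easy | apply Cmod_R]. Qed.

Definition real_scal (r : R) (x : V) : V := scal (of_R r) x.

Lemma real_scal_assoc (a b : R) (x : V) :
  real_scal a (real_scal b x) = real_scal (a * b) x.
Proof. unfold real_scal. now rewrite of_R_mult, scal_assoc. Qed.

Lemma real_scal_one (x : V) : real_scal 1 x = x.
Proof. unfold real_scal. rewrite of_R_one. apply scal_one. Qed.

Lemma real_scal_distr_l (a : R) (x y : V) :
  real_scal a (plus x y) = plus (real_scal a x) (real_scal a y).
Proof. exact (@scal_distr_l _ V (of_R a) x y). Qed.

Lemma real_scal_distr_r (a b : R) (x : V) :
  real_scal (a + b) x = plus (real_scal a x) (real_scal b x).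
Proof. unfold real_scal. rewrite of_R_plus. exact (@scal_distr_r _ V (of_R a) (of_R b) x). Qed.

Lemma norm_real_scal (a : R) (x : V) :
  norm (real_scal a x) <= Rabs a * norm x.
Proof. unfold real_scal. rewrite <- abs_of_R. exact (@norm_scal _ V (of_R a) x). Qed.

Definition real_ModuleSpace_mixin : ModuleSpace.mixin_of R_Ring V :=
  ModuleSpace.Mixin R_Ring V real_scal
    real_scal_assoc real_scal_one real_scal_distr_l real_scal_distr_r.

Definition real_NormedModuleAux_class : NormedModuleAux.class_of R_AbsRing V :=
  NormedModuleAux.Class R_AbsRing V
    (ModuleSpace.Class R_Ring V
       (AbelianGroup.class V) real_ModuleSpace_mixin)
    (UniformSpace.class V).

Definition real_NormedModule_mixin :
    NormedModule.mixin_of R_AbsRing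
      (NormedModuleAux.Pack R_AbsRing V real_NormedModuleAux_class V) :=
  NormedModule.Mixin R_AbsRing
    (NormedModuleAux.Pack R_AbsRing V real_NormedModuleAux_class V)
    (@norm _ V) (@norm_factor _ V)
    (@norm_triangle _ V) norm_real_scal
    (@norm_compat1 _ V) (@norm_compat2 _ V) (@norm_eq_zero _ V).

Definition restrict_scalars : CompleteNormedModule R_AbsRing :=
  CompleteNormedModule.Pack R_AbsRing V
    (CompleteNormedModule.Class R_AbsRing V
       (NormedModule.Class R_AbsRing V
          real_NormedModuleAux_class real_NormedModule_mixin)
       (CompleteSpace.mixin _ (CompleteSpace.class V)))
    V.

End RestrictScalars.
Arguments restrict_scalars {k} V.

(** Possibly unbounded operators: the values of [app] outside [dom] are
    irrelevant. *)

Record operator {k : scalar_field} (E F : Hilbert k) : Type := mkOperator {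
  dom : E -> Prop;
  app :> E -> F
}.
Arguments mkOperator {k E F} _ _.
Arguments dom {k E F} _ _.
Arguments app {k E F} _ _.

Definition total {k : scalar_field} {E F : Hilbert k} (L : E -> F) :
    operator E F :=
  mkOperator (fun _ => True) L.

Record linear_operator {k : scalar_field} {E F : Hilbert k}
    (A : operator E F) : Prop := {
  dom_zero : dom A zero;
  dom_plus : forall x y, dom A x -> dom A y -> dom A (plus x y);
  dom_scal : forall a x, dom A x -> dom A (scal a x);
  app_plus : forall x y, dom A x -> dom A y -> A (plus x y) = plus (A x) (A y);
  app_scal : forall a x, dom A x -> A (scal a x) = scal a (A x)
}.

Definition densely_defined {k : scalar_field} {E F : Hilbert k}
    (A : operator E F) : Prop :=
  forall (x : E) (eps : posreal), exists y, dom A y /\ ball x eps y.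

Definition closed_operator {k : scalar_field} {E F : Hilbert k}
    (A : operator E F) : Prop :=
  closed (fun p : E * F => dom A (fst p) /\ A (fst p) = snd p).

Definition dissipative {k : scalar_field} {H : Hilbert k}
    (A : operator H H) : Prop :=
  forall x, dom A x -> re (ip H (A x) x) <= 0.

Definition adjoint_at {k : scalar_field} {E F : Hilbert k}
    (A : operator E F) (y : F) (z : E) : Prop :=
  forall x, dom A x -> ip F (A x) y = ip E x z.

(* For a densely defined [A], the vector [z] with [adjoint_at A y z] is unique
   as soon as it exists. *)
Definition adjoint {k : scalar_field} {E F : Hilbert k}
    (A : operator E F) : operator F E :=
  mkOperator (fun y => exists z, adjoint_at A y z)
             (fun y => epsilon (inhabits zero) (adjoint_at A y)).

(* A - c B B^* with domain D(A); [is_linear] is Coquelicot's notion of bounded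
   linear map, and for such a [B] the adjoint is everywhere defined by the
   Riesz representation theorem. *)
Definition damping {k : scalar_field} {H U : Hilbert k}
    (B : U -> H) (x : H) : H :=
  B (adjoint (total B) x).

Definition damped {k : scalar_field} {H U : Hilbert k}
    (A : operator H H) (B : U -> H) (c : R) : operator H H :=
  mkOperator (dom A) (fun x => minus (A x) (scal (of_R c) (damping B x))).

(* Only the values S(t) with t >= 0 matter. *)
Record C0_semigroup {k : scalar_field} {H : Hilbert k}
    (S : R -> H -> H) : Prop := {
  semigroup_bounded : forall t, 0 <= t -> is_linear (S t);
  semigroup_zero : forall x, S 0 x = x;
  semigroup_plus : forall s t x, 0 <= s -> 0 <= t -> S (s + t) x = S s (S t x);
  semigroup_continuous :
    forall x, filterlim (fun t => S t x) (at_right 0) (locally x)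
}.

(* [S] is a strongly continuous semigroup whose infinitesimal generator is
   exactly [G], domain included. *)
Definition generates {k : scalar_field} {H : Hilbert k}
    (G : operator H H) (S : R -> H -> H) : Prop :=
  C0_semigroup S /\
  forall x y : H,
    (dom G x /\ G x = y) <->
    filterlim (fun h => scal (of_R (/ h)) (minus (S h x) x))
              (at_right 0) (locally y).

Definition globally_exponentially_stable {k : scalar_field} {H : Hilbert k}
    (G : operator H H) : Prop :=
  exists S, generates G S /\
  exists K0 beta0 : R, 0 < K0 /\ 0 < beta0 /\
  forall (v0 : H) (t : R), 0 <= t ->
    norm (S t v0) <= K0 * exp (- beta0 * t) * norm v0.

(* Mild solution of v' = A v - d(t) B B^* v, v(0) = v0, on [0, +oo):
   v is continuous and, with T the semigroup generated by A,
   v(t) = T(t) v0 - int_0^t T(t-s) d(s) B B^* v(s) ds.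
   Strong solutions satisfy this formula; conversely, for a d that is merely
   continuous, v0 in D(A) does not ensure that v is differentiable. *)
Definition mild_solution {k : scalar_field} {H U : Hilbert k}
    (A : operator H H) (B : U -> H) (d : R -> R) (v0 : H) (v : R -> H) : Prop :=
  exists T, generates A T /\
  continuous_on (fun t => 0 <= t) v /\
  forall t, 0 <= t ->
    is_RInt (V := restrict_scalars H)
      (fun s => T (t - s) (opp (scal (of_R (d s)) (damping B (v s)))))
      0 t (minus (v t) (T t v0)).

(* Main.v *)
(* Let P = B B^*, let S and T be the semigroups generated by A - d0 P and A, and
   let v be a mild solution. At every time s,
     v(s+h) = T(h) v(s) - h d(s) P v(s) + o(h)   as h decreases to 0,
   and T is a contraction semigroup, so |v|^2 decreases at rate at least
   2 (d0 / M^2) |P v|^2, where M bounds B. On the other hand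
   T(h) x = S(h) x + h d0 P x + o(h), so S(tau - s) v(s) moves from S(tau) v(0)
   to v(tau) at speed at most K0 d1 |P v(s)|. If tau is such that S(tau) halves
   norms, then either |P v| is small over [0, tau] and |v(tau)| is close to
   |S(tau) v(0)|, or energy is lost; in both cases |v(tau)| <= gamma |v(0)| with
   gamma < 1 depending only on the data. All estimates are one-sided, through
   right Dini derivatives, hence v need not be differentiable. *)

Require Import Defs.
From Stdlib Require Import Reals Lra Lia List ClassicalEpsilon.
From Coquelicot Require Import Coquelicot.

Local Open Scope R_scope.

(** * One-sided limits *)

(** The operator [P] enters the decay estimate only through [|P x|^2 <= M^2 <x, P x>], valid because
    [<x, P x> = |B^* x|^2]. Only real parts of inner products matter there, so the argument runs in
    the underlying real Hilbert space. The obstacle is that [v(s)] may lie outside D(A). There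
    [<A v, v>] has no meaning, and its sign is replaced by [|T(h) v(s)| <= |v(s)|]. For the same
    reason the expansion of [T(h) x - S(h) x] is needed at every [x]: on D(A) the unbounded parts
    cancel, and the operator bound [|T(h) - S(h)| = O(h)] lets the o(h) error survive approximation
    from D(A). The alternative between small [|P v|] and lost energy is not a case split. An AM-GM
    inequality with a free parameter merges both into [x <= E (y - x) + y/8 + y/2], where
    [x = |v(tau)|] and [y = |v(0)|]; solving for [x] gives gamma = (5/8 + E)/(1 + E). *)

(* [limsup (r h / w h) <= 0] as [h] decreases to [0]. *)
Definition negligible (w r : R -> R) : Prop :=
  forall eps : posreal, at_right 0 (fun h => r h <= eps * w h).

(** For nonnegative [r] these are convergence to 0 and o(h). For a signed increment only the upper
    bound is asserted, so downward jumps are harmless. *)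
Notation vanishing := (negligible (fun _ => 1)).
Notation little_o := (negligible (fun h => h)).

Lemma at_right_interval (b : R) : 0 < b -> at_right 0 (fun h => 0 < h < b).
Proof.
  intros Hb. exists (mkposreal b Hb). intros h Hh Hpos.
  apply Rabs_def2 in Hh. unfold minus, plus, opp in Hh. simpl in Hh. lra.
Qed.

Lemma at_right_pos : at_right 0 (fun h => 0 < h).
Proof. now exists (mkposreal 1 Rlt_0_1). Qed.

Lemma at_right_elim (P : R -> Prop) (c : R) :
  0 < c -> at_right 0 P -> exists b, 0 < b <= c /\ forall h, 0 < h < b -> P h.
Proof.
  intros Hc [b Hb]. pose proof (cond_pos b).
  exists (Rmin b c). split; [split; [now apply Rmin_pos | apply Rmin_r] |].
  intros h Hh. pose proof (Rmin_l b c).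
  apply Hb; [| easy]. apply Rabs_def1; unfold minus, plus, opp; simpl; lra.
Qed.

Lemma negligible_le (w r s : R -> R) :
  at_right 0 (fun h => r h <= s h) -> negligible w s -> negligible w r.
Proof.
  intros H Hs eps. generalize (filter_and _ _ H (Hs eps)).
  apply filter_imp. intros h [H1 H2]. lra.
Qed.

Lemma negligible_plus (w r s : R -> R) :
  negligible w r -> negligible w s -> negligible w (fun h => r h + s h).
Proof.
  intros Hr Hs eps.
  generalize (filter_and _ _ (Hr (pos_div_2 eps)) (Hs (pos_div_2 eps))).
  apply filter_imp. simpl. intros h [H1 H2]. lra.
Qed.

Lemma negligible_scal (w r : R -> R) (c : R) :
  0 <= c -> at_right 0 (fun h => 0 <= w h) ->
  negligible w r -> negligible w (fun h => c * r h).
Proof.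
  intros Hc Hw Hr eps.
  assert (Hp : 0 < eps / (c + 1)) by (apply Rdiv_lt_0_compat; [apply cond_pos | lra]).
  generalize (filter_and _ _ Hw (Hr (mkposreal _ Hp))).
  apply filter_imp. simpl. intros h [Hwh H].
  apply Rle_trans with (c * (eps / (c + 1) * w h)).
  - now apply Rmult_le_compat_l.
  - replace (c * (eps / (c + 1) * w h)) with (c / (c + 1) * (eps * w h)) by (field; lra).
    assert (c / (c + 1) <= 1) by (apply Rle_div_l; lra).
    assert (0 <= eps * w h) by (apply Rmult_le_pos; [apply Rlt_le, cond_pos | easy]).
    nra.
Qed.

Lemma vanishing_scal (r : R -> R) (c : R) :
  0 <= c -> vanishing r -> vanishing (fun h => c * r h).
Proof.
  intros Hc. apply negligible_scal; [easy |]. apply filter_forall. intros; lra.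
Qed.

Lemma little_o_scal (r : R -> R) (c : R) :
  0 <= c -> little_o r -> little_o (fun h => c * r h).
Proof.
  intros Hc. apply negligible_scal; [easy |].
  generalize at_right_pos. apply filter_imp. intros; lra.
Qed.

Lemma little_o_mult (r : R -> R) : vanishing r -> little_o (fun h => h * r h).
Proof.
  intros Hr eps. generalize (filter_and _ _ at_right_pos (Hr eps)).
  apply filter_imp. intros h [H1 H2]. nra.
Qed.

Lemma vanishing_id : vanishing (fun h => h).
Proof.
  intros eps. generalize (at_right_interval eps (cond_pos eps)).
  apply filter_imp. intros; lra.
Qed.

(** Continuous induction along a line of small slope [e] through [(a, g a)]. The supremum of the [s]
    up to which [g] stays below the line is attained, because the left condition forbids upward
    jumps; it equals [b], because the right condition extends the bound past any earlier point. *)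
Lemma dini_nonincreasing (g : R -> R) (a b : R) :
  a <= b ->
  (forall s, a < s <= b -> vanishing (fun h => g s - g (s - h))) ->
  (forall s, a <= s < b -> little_o (fun h => g (s + h) - g s)) ->
  g b <= g a.
Proof.
  intros Hab Hleft Hright. apply le_epsilon. intros eps Heps.
  (* The total rise [e * (b - a)] is at most [eps]; the [+ 1] keeps the denominator positive when
     [a = b]. *)
  set (e := eps / (b - a + 1)).
  assert (He : 0 < e) by (apply Rdiv_lt_0_compat; lra).
  set (good s := forall r, a <= r <= s -> g r <= g a + e * (r - a)).
  destruct (completeness (fun s => a <= s <= b /\ good s)) as [c [Hub Hlub]].
  { exists b. intros s Hs. lra. }
  { exists a. split; [lra |]. intros r Hr. replace r with a by lra. lra. }
  assert (Hac : a <= c).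
  { apply Hub. split; [lra |]. intros r Hr. replace r with a by lra. lra. }
  assert (Hcb : c <= b) by (apply Hlub; intros s Hs; lra).
  assert (Hlt : forall r, a <= r < c -> g r <= g a + e * (r - a)).
  { intros r Hr. destruct (classic (exists s, (a <= s <= b /\ good s) /\ r < s))
      as [[s [[_ Hs] Hrs]] | Hno].
    - apply Hs. lra.
    - exfalso. assert (c <= r); [| lra]. apply Hlub. intros s Hs.
      destruct (Rle_or_lt s r) as [|Hsr]; [easy |]. exfalso. apply Hno. now exists s. }
  assert (Hc : good c).
  { intros r Hr. destruct (Rle_lt_or_eq_dec r c) as [Hrc | ->]; [easy | apply Hlt; lra |].
    destruct (Rle_lt_or_eq_dec a c Hac) as [Hac' | <-]; [| lra].
    apply le_epsilon. intros eta Heta.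
    destruct (at_right_elim _ (c - a) ltac:(lra)
      (Hleft c ltac:(lra) (mkposreal eta Heta))) as [k [Hk H]].
    specialize (H (k / 2) ltac:(lra)). simpl in H.
    specialize (Hlt (c - k / 2) ltac:(lra)). nra. }
  destruct (Rle_lt_or_eq_dec c b Hcb) as [Hcb' | ->].
  - exfalso.
    destruct (at_right_elim _ (b - c) ltac:(lra)
      (Hright c ltac:(lra) (mkposreal e He))) as [k [Hk H]].
    assert (c + k / 2 <= c); [| lra]. apply Hub. split; [lra |].
    intros r Hr. destruct (Rle_or_lt r c) as [Hrc | Hrc]; [apply Hc; lra |].
    specialize (H (r - c) ltac:(lra)). simpl in H.
    replace (c + (r - c)) with r in H by ring.
    specialize (Hc c ltac:(lra)). nra.
  - specialize (Hc b ltac:(lra)).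
    assert (e * (b - a) <= eps); [| lra].
    apply Rle_trans with (e * (b - a + 1)); [nra |]. right. unfold e. field. lra.
Qed.

(** * Linear identities in real modules *)

Inductive vexpr : Type :=
  | VAtom (n : nat)
  | VZero
  | VPlus (e f : vexpr)
  | VOpp (e : vexpr)
  | VScal (r : R) (e : vexpr).

Fixpoint vcoef (e : vexpr) (n : nat) : R :=
  match e with
  | VAtom m => if Nat.eqb n m then 1 else 0
  | VZero => 0
  | VPlus e f => vcoef e n + vcoef f n
  | VOpp e => - vcoef e n
  | VScal r e => r * vcoef e n
  end.

Section LinearIdentities.

Variable V : ModuleSpace R_Ring.

Fixpoint veval (l : list V) (e : vexpr) : V :=
  match e with
  | VAtom n => nth n l zero
  | VZero => zero
  | VPlus e f => plus (veval l e) (veval l f)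
  | VOpp e => opp (veval l e)
  | VScal r e => scal r (veval l e)
  end.

(** Normal form for the reflexive tactic: with coefficients indexed by position, an equality of
    vectors reduces to one real identity per atom. *)
Fixpoint vcomb (l : list V) (c : nat -> R) : V :=
  match l with
  | nil => zero
  | x :: l => plus (scal (c 0%nat) x) (vcomb l (fun n => c (S n)))
  end.

Lemma vcomb_ext (l : list V) (c c' : nat -> R) :
  (forall n, (n < length l)%nat -> c n = c' n) -> vcomb l c = vcomb l c'.
Proof.
  revert c c'. induction l as [| x l IH]; intros c c' H; [easy |]. simpl.
  rewrite (H 0%nat) by (simpl; lia). f_equal. apply IH.
  intros n Hn. apply H. simpl. lia.
Qed.

Lemma vcomb_zero (l : list V) : vcomb l (fun _ => 0) = zero.
Proof.
  induction l as [| x l IH]; [easy |]. simpl. rewrite IH.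
  change 0 with (@zero R_Ring). now rewrite scal_zero_l, plus_zero_l.
Qed.

Lemma vcomb_atom (l : list V) (m : nat) :
  vcomb l (fun n => if Nat.eqb n m then 1 else 0) = nth m l zero.
Proof.
  revert m. induction l as [| x l IH]; intros [| m]; simpl; try easy.
  - rewrite vcomb_zero, plus_zero_r. apply (@scal_one R_Ring).
  - rewrite IH. change 0 with (@zero R_Ring). now rewrite scal_zero_l, plus_zero_l.
Qed.

Lemma vcomb_plus (l : list V) (c c' : nat -> R) :
  vcomb l (fun n => c n + c' n) = plus (vcomb l c) (vcomb l c').
Proof.
  revert c c'. induction l as [| x l IH]; intros c c'; simpl.
  - now rewrite plus_zero_l.
  - rewrite IH. change (c 0%nat + c' 0%nat) with (@plus R_Ring (c 0%nat) (c' 0%nat)).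
    rewrite scal_distr_r, <- !plus_assoc. f_equal.
    rewrite plus_comm, <- plus_assoc. f_equal. apply plus_comm.
Qed.

Lemma vcomb_scal (l : list V) (r : R) (c : nat -> R) :
  vcomb l (fun n => r * c n) = scal r (vcomb l c).
Proof.
  revert c. induction l as [| x l IH]; intros c; simpl.
  - now rewrite scal_zero_r.
  - rewrite IH, scal_distr_l. f_equal.
    change (r * c 0%nat) with (@mult R_Ring r (c 0%nat)). now rewrite scal_assoc.
Qed.

Lemma veval_vcomb (l : list V) (e : vexpr) : veval l e = vcomb l (vcoef e).
Proof.
  induction e as [n | | e IHe f IHf | e IH | r e IH]; simpl.
  - symmetry. apply vcomb_atom.
  - symmetry. apply vcomb_zero.
  - now rewrite IHe, IHf, <- vcomb_plus.
  - rewrite IH, <- (scal_opp_one (K := R_Ring)).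
    change (opp one) with (- (1)). rewrite <- vcomb_scal.
    apply vcomb_ext. intros; ring.
  - now rewrite IH, <- vcomb_scal.
Qed.

Lemma veval_eq (l : list V) (e f : vexpr) :
  (forall n, (n < length l)%nat -> vcoef e n = vcoef f n) -> veval l e = veval l f.
Proof. intros H. rewrite !veval_vcomb. now apply vcomb_ext. Qed.

End LinearIdentities.

Ltac vindex x l :=
  lazymatch l with
  | x :: _ => constr:(0%nat)
  | _ :: ?l => let n := vindex x l in constr:(S n)
  end.

Ltac vmem x l :=
  lazymatch l with
  | nil => constr:(false)
  | x :: _ => constr:(true)
  | _ :: ?l => vmem x l
  end.

Ltac vatoms e l :=
  lazymatch e with
  | minus ?a ?b => let l := vatoms a l in vatoms b l
  | plus ?a ?b => let l := vatoms a l in vatoms b l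
  | opp ?a => vatoms a l
  | scal _ ?a => vatoms a l
  | zero => l
  | _ => lazymatch vmem e l with
         | true => l
         | false => constr:(e :: l)
         end
  end.

Ltac vreify e l :=
  lazymatch e with
  | minus ?a ?b => let a := vreify a l in let b := vreify b l in
                   constr:(VPlus a (VOpp b))
  | plus ?a ?b => let a := vreify a l in let b := vreify b l in
                  constr:(VPlus a b)
  | opp ?a => let a := vreify a l in constr:(VOpp a)
  | scal ?r ?a => let a := vreify a l in constr:(VScal r a)
  | zero => constr:(VZero)
  | _ => let n := vindex e l in constr:(VAtom n)
  end.

(* Proves an equality of linear combinations with real coefficients by
   comparing the coefficients of each atom. *)
Ltac vec_with tac :=
  lazymatch goal with
  | |- @eq ?T ?a ?b =>
    let l := vatoms a (@nil T) in
    let l := vatoms b l in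
    let e := vreify a l in
    let f := vreify b l in
    refine (veval_eq _ l e f _);
    let n := fresh in
    let Hn := fresh in
    intros n Hn; simpl in Hn;
    repeat (destruct n as [| n]; [simpl; tac | try (exfalso; lia)])
  end.
Ltac vec := vec_with ltac:(ring).

(** * Real Hilbert spaces *)

Record real_inner {V : NormedModule R_AbsRing} (q : V -> V -> R) : Prop := {
  inner_plus_l : forall x y z : V, q (plus x y) z = q x z + q y z;
  inner_scal_l : forall (a : R) (x z : V), q (scal a x) z = a * q x z;
  inner_sym : forall x y, q x y = q y x;
  inner_norm : forall x, q x x = norm x ^ 2
}.

Definition norm_complete (V : NormedModule R_AbsRing) : Prop :=
  forall u : nat -> V,
  (forall eps, 0 < eps -> exists N, forall n m, (N <= n)%nat -> (N <= m)%nat ->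
    norm (minus (u m) (u n)) < eps) ->
  exists x : V, forall eps, 0 < eps -> exists N, forall n, (N <= n)%nat ->
    norm (minus (u n) x) < eps.

Lemma complete_norm_complete (V : CompleteNormedModule R_AbsRing) : norm_complete V.
Proof.
  intros u H.
  destruct (proj1 (filterlim_locally_cauchy (F := eventually) u)) as [x Hx].
  - intros eps. destruct (H eps (cond_pos eps)) as [N HN].
    exists (fun n => (N <= n)%nat). split; [now exists N |].
    intros n m Hn Hm. apply (norm_compat1 (u n) (u m) eps). now apply HN.
  - exists x. intros eps Heps.
    pose proof (proj1 (filterlim_locally_ball_norm (F := eventually) u x) Hx
      (mkposreal eps Heps)) as [N HN].
    exists N. intros n Hn. exact (HN n Hn).
Qed.

Section RealHilbert.

Context {V : NormedModule R_AbsRing}.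

Lemma norm_le_plus (x y z : V) : x = plus y z -> norm x <= norm y + norm z.
Proof. intros ->. apply (norm_triangle y z). Qed.

(** The axiom of a normed module gives [<=]; applying it to [/ a] and [scal a x] gives the
    reverse. *)
Lemma norm_scal_real (a : R) (x : V) : norm (scal a x) = Rabs a * norm x.
Proof.
  apply Rle_antisym; [apply (norm_scal a x) |].
  destruct (Req_dec a 0) as [-> | Ha].
  - rewrite Rabs_R0. generalize (norm_ge_0 (scal 0 x)). lra.
  - apply Rmult_le_reg_l with (/ Rabs a).
    { now apply Rinv_0_lt_compat, Rabs_pos_lt. }
    rewrite <- Rmult_assoc, Rinv_l, Rmult_1_l by now apply Rabs_no_R0.
    replace x with (scal (/ a) (scal a x)) at 1.
    + rewrite <- Rabs_inv. apply (norm_scal (/ a) (scal a x)).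
    + transitivity (scal 1 x); [vec_with ltac:(now field) | vec].
Qed.

Lemma norm_minus_sym (x y : V) : norm (minus x y) = norm (minus y x).
Proof. rewrite <- norm_opp. f_equal. vec. Qed.

Lemma norm_minus_self (x : V) : norm (minus x x) = 0.
Proof. rewrite <- (@norm_zero _ V). f_equal. vec. Qed.

Variable q : V -> V -> R.
Hypothesis Hq : real_inner q.

Lemma inner_plus_r (x y z : V) : q x (plus y z) = q x y + q x z.
Proof. now rewrite (inner_sym q Hq x), (inner_plus_l q Hq), !(inner_sym q Hq _ x). Qed.

Lemma inner_scal_r (a : R) (x y : V) : q x (scal a y) = a * q x y.
Proof. now rewrite (inner_sym q Hq x), (inner_scal_l q Hq), !(inner_sym q Hq _ x). Qed.

Lemma inner_minus_r (x y z : V) : q x (minus y z) = q x y - q x z.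
Proof.
  replace (minus y z) with (plus y (scal (Ropp 1) z)) by vec.
  rewrite inner_plus_r, inner_scal_r. ring.
Qed.

Lemma inner_separates (x y : V) : (forall u, q u x = q u y) -> x = y.
Proof.
  intros H.
  assert (E : minus x y = zero).
  { apply norm_eq_zero. pose proof (norm_ge_0 (minus x y)).
    pose proof (inner_norm q Hq (minus x y)) as H1.
    rewrite inner_minus_r, H in H1. nra. }
  transitivity (plus y (minus x y)); [vec | rewrite E; vec].
Qed.

Lemma norm_plus_sqr (x y : V) :
  norm (plus x y) ^ 2 = norm x ^ 2 + 2 * q x y + norm y ^ 2.
Proof.
  rewrite <- !(inner_norm q Hq), (inner_plus_l q Hq), !inner_plus_r, (inner_sym q Hq y x).
  ring.
Qed.

(* Expanding the square of the triangle inequality. *)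
Lemma inner_le_norm (x y : V) : q x y <= norm x * norm y.
Proof.
  pose proof (norm_plus_sqr x y). pose proof (norm_le_plus (plus x y) x y eq_refl).
  pose proof (norm_ge_0 (plus x y)).
  assert (norm (plus x y) ^ 2 <= (norm x + norm y) ^ 2) by (apply pow_incr; lra).
  nra.
Qed.

Lemma Rabs_inner_le (x y : V) : Rabs (q x y) <= norm x * norm y.
Proof.
  apply Rabs_le. split; [| apply inner_le_norm].
  pose proof (inner_le_norm (scal (Ropp 1) x) y) as H.
  rewrite (inner_scal_l q Hq), norm_scal_real, Rabs_Ropp, Rabs_R1 in H. lra.
Qed.

(* The representing vector minimises [norm u ^ 2 - 2 * l u]. *)
Lemma riesz (l : V -> R) (M : R) :
  norm_complete V ->
  (forall x y, l (plus x y) = l x + l y) ->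
  (forall a x, l (scal a x) = a * l x) ->
  (forall x, Rabs (l x) <= M * norm x) ->
  exists z : V, forall u, l u = q u z.
Proof.
  intros Hcomplete Hplus Hscal HM.
  set (J u := norm u ^ 2 - 2 * l u).
  assert (HJ : forall x u w : V, x = plus u w -> J x = J u + 2 * (q u w - l w) + norm w ^ 2).
  { intros x u w ->. unfold J. rewrite norm_plus_sqr, Hplus. ring. }
  (* [m] is minus the infimum of [J], finite because completing the square gives
     [J u >= - M ^ 2]. *)
  destruct (completeness (fun r => exists u, r = - J u)) as [m [Hub Hlub]].
  { exists (M ^ 2). intros r [u ->]. unfold J.
    pose proof (proj2 (proj1 (Rabs_le_between _ _) (HM u))).
    pose proof (pow2_ge_0 (norm u - M)). nra. }
  { now exists (- J zero), zero. }
  assert (Hlow : forall u, - m <= J u).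
  { intros u. cut (- J u <= m); [lra |]. apply Hub. now exists u. }
  assert (Hmin : forall n, exists u, J u <= - m + / INR (S n)).
  { intros n. pose proof (RinvN_pos n) as Hn. rewrite <- S_INR in Hn.
    destruct (classic (exists u, J u <= - m + / INR (S n))) as [|Hno]; [easy |].
    exfalso. assert (m <= m - / INR (S n)); [| lra].
    apply Hlub. intros r [u ->]. destruct (Rle_or_lt (J u) (- m + / INR (S n))).
    - exfalso. apply Hno. now exists u.
    - lra. }
  set (u n := proj1_sig (constructive_indefinite_description _ (Hmin n))).
  assert (Hu : forall n, J (u n) <= - m + / INR (S n)).
  { intros n. unfold u. now destruct constructive_indefinite_description. }
  assert (Hinv : forall eps, 0 < eps ->
    exists N, forall n, (N <= n)%nat -> / INR (S n) < eps).
  { intros eps Heps. destruct (archimed_cor1 eps Heps) as [N [HN HN0]].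
    exists N. intros n Hn. apply Rle_lt_trans with (/ INR N); [| easy].
    apply Rinv_le_contravar; [now apply lt_0_INR | apply le_INR; lia]. }
  (* parallelogram identity *)
  assert (Hpar : forall x y : V, norm (minus y x) ^ 2 <= 2 * (J x + m) + 2 * (J y + m)).
  { intros x y. pose proof (Hlow (plus x (scal (/2) (minus y x)))) as H1.
    pose proof (HJ y x (minus y x) ltac:(vec)) as H2.
    rewrite (HJ _ _ _ eq_refl) in H1. rewrite inner_scal_r, Hscal, norm_scal_real in H1.
    rewrite Rabs_pos_eq in H1 by lra.
    lra. }
  destruct (Hcomplete u) as [z Hz].
  { intros eps Heps. destruct (Hinv (eps ^ 2 / 4)) as [N HN].
    { pose proof (pow_lt eps 2 Heps). lra. }
    exists N. intros n k Hn Hk. pose proof (HN n Hn). pose proof (HN k Hk).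
    pose proof (Hu n). pose proof (Hu k). pose proof (Hpar (u n) (u k)).
    apply Rnot_le_lt. intros Hle.
    assert (eps ^ 2 <= norm (minus (u k) (u n)) ^ 2)
      by (apply pow_incr; split; [lra | exact Hle]).
    lra. }
  assert (HJz : J z <= - m).
  { apply le_epsilon. intros eps Heps.
    (* With [w] the difference of [u n] and [z], [J z] exceeds [J (u n)] by at most
       [2 * C * norm w <= eps / 4], and [J (u n)] exceeds the infimum by at most [eps / 2]. *)
    set (C := norm z + Rabs M + 1).
    assert (HC : 0 < C) by (pose proof (norm_ge_0 z); pose proof (Rabs_pos M); unfold C; lra).
    destruct (Hz (Rmin 1 (eps / (8 * C)))) as [N1 HN1].
    { apply Rmin_pos; [lra |]. apply Rdiv_lt_0_compat; lra. }
    destruct (Hinv (eps / 2)) as [N2 HN2]; [lra |].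
    set (n := max N1 N2).
    specialize (HN1 n (Nat.le_max_l _ _)). specialize (HN2 n (Nat.le_max_r _ _)).
    pose proof (HJ (u n) z (minus (u n) z) ltac:(vec)) as H.
    set (w := minus (u n) z : V) in *.
    pose proof (Rmin_l 1 (eps / (8 * C))). pose proof (Rmin_r 1 (eps / (8 * C))).
    assert (norm w * (8 * C) <= eps) by (apply Rle_div_r; lra).
    pose proof (proj1 (proj1 (Rabs_le_between _ _) (Rabs_inner_le z w))).
    pose proof (proj2 (proj1 (Rabs_le_between _ _) (HM w))).
    pose proof (RRle_abs M). pose proof (norm_ge_0 w).
    pose proof (Hu n). pose proof (pow2_ge_0 (norm w)).
    unfold C in *. nra. }
  exists z. intros w.
  rewrite (inner_sym q Hq).
  (* otherwise a small step from [z] along [w] decreases [J] *)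
  assert (H : forall a, 0 <= 2 * a * (q z w - l w) + a ^ 2 * norm w ^ 2).
  { intros a. pose proof (HJ _ z (scal a w) eq_refl) as H.
    rewrite inner_scal_r, Hscal, norm_scal_real, Rpow_mult_distr, pow2_abs in H.
    pose proof (Hlow (plus z (scal a w))). lra. }
  set (c := q z w - l w) in *. set (N := norm w ^ 2) in *.
  assert (HN : 0 <= N) by apply pow2_ge_0.
  assert (Hc : c = 0); [| unfold c in Hc; lra].
  (* The minimiser of this quadratic in [a] is [- c / N]; the [+ 1] covers [N = 0] and still gives a
     negative value unless [c = 0]. *)
  specialize (H (- c / (N + 1))).
  replace (2 * (- c / (N + 1)) * c + (- c / (N + 1)) ^ 2 * N)
    with (- (c ^ 2 * (N + 2)) / (N + 1) ^ 2) in H by (field; lra).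
  destruct (Req_dec c 0) as [|Hc]; [easy |]. exfalso.
  assert (0 < c ^ 2 * (N + 2) / (N + 1) ^ 2); [| lra].
  apply Rdiv_lt_0_compat; [| apply pow_lt; lra].
  apply Rmult_lt_0_compat; [| lra]. pose proof (pow2_gt_0 c Hc). lra.
Qed.

(** Expand the square around [xh h], which only has to converge to [x], at no given rate. This
    allows [xh h = T h x] with [x] outside the domain of the generator. Cauchy-Schwarz makes every
    remaining term [N h] or [h] times a vanishing quantity. *)
Lemma sqr_norm_increment (x a : V) (xh yh : R -> V) :
  vanishing (fun h => norm (minus (xh h) x)) ->
  little_o (fun h => norm (minus (yh h) (plus (xh h) (scal h a)))) ->
  little_o (fun h => norm (yh h) ^ 2 - norm (xh h) ^ 2 - h * (2 * q x a)).
Proof.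
  intros Hx Hy.
  set (N h := norm (minus (yh h) (plus (xh h) (scal h a)))) in *.
  set (X h := norm (minus (xh h) x)) in *.
  pose proof (norm_ge_0 a) as Ha. pose proof (norm_ge_0 x) as Hx0.
  apply negligible_le with
    (fun h => (2 * (norm x + 1)) * N h + h * (2 * norm a * X h + (1 + norm a) ^ 2 * h)).
  - generalize (filter_and _ _ at_right_pos
      (filter_and _ _ (Hx (mkposreal 1 Rlt_0_1)) (Hy (mkposreal 1 Rlt_0_1)))).
    apply filter_imp. intros h [Hh [H1 H2]]. simpl in H1, H2.
    rewrite Rmult_1_l in H1, H2.
    set (n := minus (yh h) (plus (xh h) (scal h a)) : V).
    assert (E : yh h = plus (xh h) (plus n (scal h a))) by (unfold n; vec).
    rewrite E at 1. rewrite norm_plus_sqr, inner_plus_r, inner_scal_r.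
    assert (E2 : q (xh h) a = q (minus (xh h) x) a + q x a).
    { rewrite <- (inner_plus_l q Hq). f_equal. vec. }
    rewrite E2.
    pose proof (inner_le_norm (minus (xh h) x) a) as I1. fold (X h) in I1.
    pose proof (inner_le_norm (xh h) n) as I2. change (norm n) with (N h) in I2.
    pose proof (norm_le_plus (xh h) (minus (xh h) x) x ltac:(vec)) as I3. fold (X h) in I3.
    pose proof (norm_le_plus (plus n (scal h a)) n (scal h a) eq_refl) as I4. change (norm n) with (N h) in I4.
    rewrite norm_scal_real, Rabs_pos_eq in I4 by lra.
    pose proof (norm_ge_0 (plus n (scal h a))).
    assert (0 <= N h) by apply norm_ge_0.
    assert (norm (plus n (scal h a)) ^ 2 <= (h * (1 + norm a)) ^ 2) by (apply pow_incr; nra).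
    assert (norm (xh h) * N h <= (norm x + 1) * N h) by (apply Rmult_le_compat_r; lra).
    assert (h * q (minus (xh h) x) a <= h * (X h * norm a)) by (apply Rmult_le_compat_l; lra).
    nra.
  - apply negligible_plus.
    + apply little_o_scal; [lra | easy].
    + apply little_o_mult, negligible_plus.
      * apply vanishing_scal; [lra | easy].
      * apply vanishing_scal; [apply pow2_ge_0 | apply vanishing_id].
Qed.

End RealHilbert.

(** * Strongly continuous semigroups *)

Section Semigroup.

Context {V : NormedModule R_AbsRing}.

Record real_semigroup (T : R -> V -> V) : Prop := {
  rs_linear : forall t, 0 <= t -> is_linear (T t);
  rs_zero : forall x, T 0 x = x;
  rs_plus : forall s t x, 0 <= s -> 0 <= t -> T (s + t) x = T s (T t x);
  rs_continuous : forall x : V, vanishing (fun h => norm (minus (T h x) x))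
}.

(** The generator's difference quotient multiplied by [h], so that expansions can be added and
    transported directly. *)
Definition derivative_at_0 (T : R -> V -> V) (x y : V) : Prop :=
  little_o (fun h => norm (minus (T h x) (plus x (scal h y)))).

Lemma derivative_at_0_quotient (T : R -> V -> V) (x y : V) :
  (forall eps : posreal,
    at_right 0 (fun h => norm (minus (scal (/ h) (minus (T h x) x)) y) < eps)) <->
  derivative_at_0 T x y.
Proof.
  assert (E : forall h, 0 < h ->
    norm (minus (scal (/ h) (minus (T h x) x)) y) * h
    = norm (minus (T h x) (plus x (scal h y)))).
  { intros h Hh. rewrite Rmult_comm. rewrite <- (Rabs_pos_eq h) at 1 by lra.
    rewrite <- norm_scal_real. f_equal. vec_with ltac:(field; lra). }
  split; intros Hlim eps.
  - generalize (filter_and _ _ at_right_pos (Hlim eps)). apply filter_imp.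
    intros h [Hh H]. rewrite <- E by easy. apply Rmult_le_compat_r; lra.
  - generalize (filter_and _ _ at_right_pos (Hlim (pos_div_2 eps))). apply filter_imp.
    intros h [Hh H]. rewrite <- E in H by easy. apply Rmult_le_reg_r in H; [| easy].
    simpl in H. pose proof (cond_pos eps). lra.
Qed.

Lemma linear_minus (L : V -> V) (x y : V) :
  is_linear L -> L (minus x y) = minus (L x) (L y).
Proof.
  intros HL. replace (minus x y) with (plus x (scal (Ropp 1) y)) by vec.
  rewrite (linear_plus L HL), (linear_scal L HL). vec.
Qed.

Lemma linear_zero (L : V -> V) : is_linear L -> L zero = zero.
Proof.
  intros HL. replace (@zero V) with (scal 0 (@zero V)) by vec.
  rewrite (linear_scal L HL). vec.
Qed.

(** [2 L u] is the difference of [L (x + u)] and [L (x - u)], so one of the two is at least as large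
    as [L u]. Large values of [L] thus occur near every centre [x], as the nested balls require. *)
Lemma large_nearby (L : V -> V) (x u : V) :
  is_linear L -> exists y : V, norm (minus y x) = norm u /\ norm (L u) <= norm (L y).
Proof.
  intros HL.
  assert (H : 2 * norm (L u) <= norm (L (plus x u)) + norm (L (minus x u))).
  { rewrite linear_minus, (linear_plus L HL) by easy.
    replace 2 with (Rabs 2) by (apply Rabs_pos_eq; lra).
    rewrite <- norm_scal_real, <- (norm_opp (minus (L x) (L u))).
    apply norm_le_plus. vec. }
  destruct (Rle_or_lt (norm (L u)) (norm (L (plus x u)))).
  - exists (plus x u). split; [f_equal; vec | easy].
  - exists (minus x u). split; [| lra].
    rewrite norm_minus_sym. f_equal. vec.
Qed.

(* Uniform boundedness principle, by nested balls. *)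
Lemma semigroup_locally_bounded (T : R -> V -> V) :
  norm_complete V -> real_semigroup T ->
  exists delta M, 0 < delta /\
    forall t x, 0 <= t <= delta -> norm (T t x) <= M * norm x.
Proof.
  intros Hcomplete HT. apply NNPP. intros Hno.
  (* [1 <= M] excludes [t = 0], where [T t] is the identity. *)
  assert (Hbig : forall (delta M : R), 0 < delta -> 1 <= M ->
    exists t x, 0 < t <= delta /\ M * norm x < norm (T t x)).
  { intros delta M Hdelta HM. apply NNPP. intros Hno'. apply Hno.
    exists delta, M. split; [easy |]. intros t x Ht.
    destruct (Rle_lt_or_eq_dec 0 t (proj1 Ht)) as [Ht' | <-].
    - apply Rnot_lt_le. intros Hlt. apply Hno'. exists t, x. lra.
    - rewrite (rs_zero T HT). pose proof (norm_ge_0 x). nra. }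
  assert (Hstep : forall (n : nat) (b : V * posreal), exists p : R * (V * posreal),
    let '(t, (y, r)) := p in
    0 < t <= / INR (S n) /\ r <= snd b / 2 /\ norm (minus y (fst b)) <= snd b / 2 /\
    forall z, norm (minus z y) <= r -> INR n <= norm (T t z)).
  { intros n [x r]. simpl fst. simpl snd. pose proof (cond_pos r) as Hr.
    pose proof (pos_INR n) as Hn.
    pose proof (RinvN_pos n) as Hn'. rewrite <- S_INR in Hn'.
    (* Once [u] is rescaled to norm [r / 2], this [M] makes the image at least [r / 2 + (n + 1)] in
       norm. *)
    set (M := 1 + 2 * (INR n + 1) / r).
    assert (HM : 0 < 2 * (INR n + 1) / r) by (apply Rdiv_lt_0_compat; lra).
    destruct (Hbig (/ INR (S n)) M Hn' ltac:(unfold M; lra)) as [t [u [Ht Hu]]].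
    assert (HL : is_linear (T t)) by (apply (rs_linear T HT); lra).
    assert (Hu0 : 0 < norm u).
    { destruct (norm_ge_0 u) as [|E]; [easy |]. symmetry in E.
      apply norm_eq_zero in E. subst u.
      rewrite linear_zero, norm_zero in Hu by easy. lra. }
    set (c := r / (2 * norm u)).
    assert (Hc : 0 < c) by (apply Rdiv_lt_0_compat; lra).
    destruct (large_nearby (T t) x (scal c u) HL) as [y [Hy HTy]].
    rewrite (linear_scal _ HL), norm_scal_real, Rabs_pos_eq in HTy by lra.
    rewrite norm_scal_real, Rabs_pos_eq in Hy by lra.
    replace (c * norm u) with (r / 2) in Hy by (unfold c; field; lra).
    assert (HTy' : INR n + 1 <= norm (T t y)).
    { apply Rle_trans with (c * norm (T t u)); [| easy].
      apply Rle_trans with (c * (M * norm u)); [| apply Rmult_le_compat_l; lra].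
      replace (c * (M * norm u)) with (r / 2 + (INR n + 1)); [lra |].
      unfold c, M. field. lra. }
    destruct (linear_norm _ HL) as [C [HC HTC]].
    (* Radius [r / 2] keeps the new ball inside the old one; radius [/ C] lets [T t] vary by at most
       1 on it, so that [n] remains of [n + 1]. *)
    assert (Hr' : 0 < Rmin (r / 2) (/ C)).
    { apply Rmin_pos; [lra | now apply Rinv_0_lt_compat]. }
    exists (t, (y, mkposreal _ Hr')). simpl.
    split; [easy |]. split; [apply Rmin_l |]. split; [lra |].
    intros z Hz. pose proof (Rmin_r (r / 2) (/ C)).
    pose proof (HTC (minus z y)) as H1. rewrite linear_minus in H1 by easy.
    assert (C * norm (minus z y) <= C * / C) by (apply Rmult_le_compat_l; lra).
    rewrite Rinv_r in H0 by lra.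
    pose proof (norm_le_plus (T t y) (T t z) (minus (T t y) (T t z)) ltac:(vec)) as H2.
    rewrite (norm_minus_sym (T t y)) in H2. lra. }
  set (F n b := proj1_sig (constructive_indefinite_description _ (Hstep n b))).
  set (ball := fix ball (n : nat) : V * posreal :=
    match n with 0%nat => (zero, mkposreal 1 Rlt_0_1) | S n => snd (F n (ball n)) end).
  set (x n := fst (ball n)). set (r n := pos (snd (ball n))).
  set (t n := fst (F n (ball n))).
  assert (HF : forall n, 0 < t n <= / INR (S n) /\ r (S n) <= r n / 2 /\
    norm (minus (x (S n)) (x n)) <= r n / 2 /\
    forall z, norm (minus z (x (S n))) <= r (S n) -> INR n <= norm (T (t n) z)).
  { intros n. unfold x, r, t. simpl. unfold F.
    destruct (constructive_indefinite_description _ (Hstep n (ball n)))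
      as [[tn [y rn]] H]. exact H. }
  assert (Hr : forall n, 0 < r n) by (intros n; apply cond_pos).
  assert (Hnest : forall n k, norm (minus (x (n + k)%nat) (x n)) <= r n - r (n + k)%nat).
  { intros n k. induction k as [| k IH].
    - rewrite Nat.add_0_r.
      rewrite norm_minus_self. lra.
    - rewrite Nat.add_succ_r. destruct (HF (n + k)%nat) as [_ [H1 [H2 _]]].
      pose proof (norm_le_plus (minus (x (S (n + k))) (x n))
        (minus (x (S (n + k))) (x (n + k)%nat)) (minus (x (n + k)%nat) (x n))
        ltac:(vec)). lra. }
  assert (Hsmall : forall n, r n <= / INR (S n)).
  { induction n as [| n IH]; [right; unfold r; simpl; field |].
    destruct (HF n) as [_ [H1 _]].
    apply Rle_trans with (/ INR (S n) / 2); [lra |].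
    rewrite !S_INR. pose proof (pos_INR n).
    replace (/ (INR n + 1) / 2) with (/ (2 * (INR n + 1))) by (field; lra).
    apply Rinv_le_contravar; lra. }
  assert (Hr0 : forall eps, 0 < eps -> exists N, r N < eps).
  { intros eps Heps. destruct (archimed_cor1 eps Heps) as [N [HN HN0]]. exists N.
    apply Rle_lt_trans with (/ INR (S N)); [apply Hsmall |].
    apply Rle_lt_trans with (/ INR N); [| easy].
    apply Rinv_le_contravar; [now apply lt_0_INR | apply le_INR; lia]. }
  destruct (Hcomplete x) as [l Hl].
  { intros eps Heps. destruct (Hr0 (eps / 2)) as [N HN]; [lra |].
    exists N. intros n m Hn Hm.
    pose proof (Hnest N (n - N)%nat) as H1. pose proof (Hnest N (m - N)%nat) as H2.
    pose proof (Hr (N + (n - N))%nat). pose proof (Hr (N + (m - N))%nat).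
    replace (N + (n - N))%nat with n in * by lia.
    replace (N + (m - N))%nat with m in * by lia.
    rewrite norm_minus_sym in H1.
    pose proof (norm_le_plus (minus (x m) (x n)) (minus (x m) (x N))
      (minus (x N) (x n)) ltac:(vec)). lra. }
  assert (Hin : forall n, norm (minus l (x n)) <= r n).
  { intros n. apply le_epsilon. intros eps Heps.
    destruct (Hl eps Heps) as [N HN]. specialize (HN (n + N)%nat ltac:(lia)).
    rewrite norm_minus_sym in HN.
    pose proof (Hnest n N). pose proof (Hr (n + N)%nat).
    pose proof (norm_le_plus (minus l (x n)) (minus l (x (n + N)%nat))
      (minus (x (n + N)%nat) (x n)) ltac:(vec)). lra. }
  (* The common point [l] satisfies [norm (T (t n) l) >= n] with [t n] tending to 0, whereas strong
     continuity at 0 gives [norm (T h l) <= norm l + 1] for small [h]. *)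
  destruct (at_right_elim _ 1 Rlt_0_1 (rs_continuous T HT l (mkposreal 1 Rlt_0_1)))
    as [b [Hb H]].
  destruct (archimed_cor1 b (proj1 Hb)) as [N [HN HN0]].
  destruct (nfloor_ex (norm l + 2)) as [K [_ HK]].
  { pose proof (norm_ge_0 l). lra. }
  set (n := (N + S K)%nat).
  destruct (HF n) as [Htn [_ [_ Hbn]]]. specialize (Hbn l (Hin (S n))).
  assert (Hn : norm l + 2 <= INR n).
  { unfold n. rewrite plus_INR, S_INR. pose proof (pos_INR N). lra. }
  assert (Htb : 0 < t n < b).
  { split; [lra |]. apply Rle_lt_trans with (/ INR (S n)); [easy |].
    apply Rle_lt_trans with (/ INR N); [| easy].
    apply Rinv_le_contravar; [now apply lt_0_INR | apply le_INR; unfold n; lia]. }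
  specialize (H (t n) Htb). simpl in H.
  pose proof (norm_le_plus (T (t n) l) (minus (T (t n) l) l) l ltac:(vec)). lra.
Qed.

Lemma sqr_norm_left_continuous (u : R -> V) (s : R) :
  vanishing (fun h => norm (minus (u s) (u (s - h)))) ->
  vanishing (fun h => norm (u s) ^ 2 - norm (u (s - h)) ^ 2).
Proof.
  intros Hu. pose proof (norm_ge_0 (u s)).
  apply negligible_le with (fun h => (2 * norm (u s)) * norm (minus (u s) (u (s - h)))).
  - apply filter_forall. intros h.
    pose proof (norm_le_plus (u s) (minus (u s) (u (s - h))) (u (s - h)) ltac:(vec)).
    pose proof (norm_ge_0 (u (s - h))).
    pose proof (norm_ge_0 (minus (u s) (u (s - h)))).
    (* Either the increment is nonpositive, or [norm (u (s - h))] is below [norm (u s)] and the sum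
       of the two is at most [2 * norm (u s)]. *)
    destruct (Rle_or_lt (norm (u s)) (norm (u (s - h)))); nra.
  - apply vanishing_scal; [lra | easy].
Qed.

(** The difference is [T (s - h)] applied to [T h x - x]. The outer operator moves with [h], which
    is why a bound uniform in time is required. *)
Lemma orbit_left_continuous (T : R -> V -> V) (b M s : R) (x : V) :
  real_semigroup T -> (forall t x, 0 <= t <= b -> norm (T t x) <= M * norm x) ->
  0 < s <= b -> vanishing (fun h => norm (minus (T s x) (T (s - h) x))).
Proof.
  intros HT HM Hs.
  apply negligible_le with (fun h => Rabs M * norm (minus (T h x) x)).
  - generalize (at_right_interval s (proj1 Hs)). apply filter_imp. intros h Hh.
    replace s with (s - h + h) at 1 by ring.
    rewrite (rs_plus T HT), <- linear_minus by (try apply (rs_linear T HT); lra).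
    eapply Rle_trans; [apply HM; lra |].
    apply Rmult_le_compat_r; [apply norm_ge_0 | apply RRle_abs].
  - apply vanishing_scal; [apply Rabs_pos | apply (rs_continuous T HT)].
Qed.

(** The crude constant [M] only supplies continuity of [L]; it does not enter the resulting
    bound. *)
Lemma dense_bound (D : V -> Prop) (L : V -> V) (M C : R) :
  (forall (x : V) eps, 0 < eps -> exists y, D y /\ norm (minus y x) < eps) ->
  (forall x y, L (minus x y) = minus (L x) (L y)) ->
  (forall x, norm (L x) <= M * norm x) -> 0 <= C ->
  (forall y, D y -> norm (L y) <= C * norm y) ->
  forall x, norm (L x) <= C * norm x.
Proof.
  intros Hdense HL HM HC HD x. apply le_epsilon. intros eps Heps.
  set (c := C + Rabs M + 1).
  assert (Hc : 0 < c) by (pose proof (Rabs_pos M); unfold c; lra).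
  destruct (Hdense x (eps / c)) as [y [Hy Hyx]]; [now apply Rdiv_lt_0_compat |].
  assert (norm (minus y x) * c <= eps) by (apply Rle_div_r; lra).
  pose proof (HD y Hy) as H1. pose proof (HM (minus y x)) as H2. rewrite HL in H2.
  pose proof (norm_le_plus (L x) (L y) (minus (L x) (L y)) ltac:(vec)) as H3.
  rewrite (norm_minus_sym (L x)) in H3.
  pose proof (norm_le_plus y x (minus y x) ltac:(vec)).
  pose proof (RRle_abs M). pose proof (norm_ge_0 (minus y x)).
  unfold c in *. nra.
Qed.

(* Orbits starting in the domain stay in it; the energy of such an orbit has a
   nonpositive right derivative. *)
Lemma dissipative_contraction (q : V -> V -> R) (T : R -> V -> V)
    (D : V -> Prop) (A : V -> V) :
  norm_complete V -> real_inner q -> real_semigroup T ->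
  (forall x y, (D x /\ A x = y) <-> derivative_at_0 T x y) ->
  (forall (x : V) eps, 0 < eps -> exists y, D y /\ norm (minus y x) < eps) ->
  (forall x, D x -> q (A x) x <= 0) ->
  (forall t x, 0 <= t -> norm (T t x) <= norm x) /\
  (forall t x, 0 <= t -> D x -> D (T t x)).
Proof.
  intros Hcomplete Hq HT Hgen Hdense Hdiss.
  assert (Hinv : forall t x, 0 <= t -> D x -> D (T t x)).
  { intros t x Ht Hx. apply (proj2 (Hgen (T t x) (T t (A x)))).
    assert (HL := rs_linear T HT t Ht). destruct (linear_norm _ HL) as [M [HM HTM]].
    apply negligible_le with (fun h => M * norm (minus (T h x) (plus x (scal h (A x))))).
    - generalize at_right_pos. apply filter_imp. intros h Hh.
      rewrite <- (rs_plus T HT), Rplus_comm, (rs_plus T HT) by lra.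
      rewrite <- (linear_scal _ HL), <- (linear_plus _ HL), <- linear_minus by easy.
      apply HTM.
    - apply little_o_scal; [lra |]. now apply (Hgen x (A x)). }
  split; [| exact Hinv].
  (* The local bound gives left continuity of orbits, hence contraction on [[0, delta]] by the Dini
     argument; the semigroup law then covers all times. *)
  destruct (semigroup_locally_bounded T Hcomplete HT) as [delta [M [Hdelta HM]]].
  assert (Hloc : forall t x, 0 <= t <= delta -> norm (T t x) <= norm x).
  { intros t x Ht. rewrite <- (Rmult_1_l (norm x)).
    apply (dense_bound D (T t) M 1); try easy.
    - intros y z. apply linear_minus, (rs_linear T HT), Ht.
    - intros y. now apply HM.
    - lra.
    - intros y Hy. rewrite Rmult_1_l.
      apply Rsqr_incr_0; try apply norm_ge_0. rewrite !Rsqr_pow2.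
      rewrite <- (rs_zero T HT y) at 2.
      apply (dini_nonincreasing (fun s => norm (T s y) ^ 2)); [easy | |].
      + intros s Hs. apply (sqr_norm_left_continuous (fun s => T s y)).
        apply (orbit_left_continuous T delta M); try easy. lra.
      + intros s Hs. set (z := T s y).
        assert (Hz : D z) by (apply Hinv; [lra | easy]).
        apply negligible_le with (fun h => norm (T h z) ^ 2 - norm z ^ 2 - h * (2 * q z (A z))).
        * generalize at_right_pos. apply filter_imp. intros h Hh.
          rewrite Rplus_comm, (rs_plus T HT) by lra. fold z.
          pose proof (Hdiss z Hz) as H. rewrite (inner_sym q Hq) in H. nra.
        * apply (sqr_norm_increment q Hq z (A z) (fun _ => z) (fun h => T h z)).
          -- apply negligible_le with (fun h => h); [| apply vanishing_id].
             generalize at_right_pos. apply filter_imp. intros h Hh.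
             rewrite norm_minus_self. lra.
          -- now apply Hgen. }
  assert (Hall : forall n t x, 0 <= t <= INR n * delta -> norm (T t x) <= norm x).
  { induction n as [| n IH]; intros t x Ht.
    - simpl in Ht. apply Hloc. lra.
    - rewrite S_INR in Ht. destruct (Rle_or_lt t delta); [apply Hloc; lra |].
      replace t with (delta + (t - delta)) by ring. rewrite (rs_plus T HT) by lra.
      eapply Rle_trans; [apply Hloc; lra | apply IH; lra]. }
  intros t x Ht. destruct (nfloor_ex (t / delta)) as [n [_ Hn]].
  { apply Rdiv_le_0_compat; lra. }
  apply (Hall (S n)). split; [easy |]. rewrite S_INR. apply Rle_div_l; lra.
Qed.

(** * Bounded perturbations *)

Section Comparison.

Variables (S : R -> V -> V) (K : R).
Hypothesis HS : real_semigroup S.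
Hypothesis HK : 0 <= K.
Hypothesis HSK : forall t x, 0 <= t -> norm (S t x) <= K * norm x.

(** The curve [S (t - s) (u s)] joins [S t (u 0)] to [u t], as in Duhamel's formula. Moving [z] by
    [S h] first puts the same operator in front of [u s] and [u (s - h)], and its bound [K]
    applies. *)
Lemma transported_left_continuous (u : R -> V) (c : V) (s t : R) :
  0 < s <= t -> vanishing (fun h => norm (minus (u s) (u (s - h)))) ->
  vanishing (fun h => norm (minus (S (t - s) (u s)) c)
                      - norm (minus (S (t - (s - h)) (u (s - h))) c)).
Proof.
  intros Hs Hu. set (z := S (t - s) (u s)).
  apply negligible_le with
    (fun h => norm (minus (S h z) z) + K * norm (minus (u s) (u (s - h)))).
  - generalize at_right_pos. apply filter_imp. intros h Hh.
    set (w := S (t - (s - h)) (u (s - h))).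
    pose proof (norm_le_plus (minus z c) (minus z w) (minus w c) ltac:(vec)).
    pose proof (norm_le_plus (minus z w) (minus z (S h z)) (minus (S h z) w) ltac:(vec)) as H1.
    rewrite (norm_minus_sym z (S h z)) in H1.
    assert (norm (minus (S h z) w) <= K * norm (minus (u s) (u (s - h)))); [| lra].
    unfold z, w. replace (t - (s - h)) with (h + (t - s)) by ring.
    rewrite <- (rs_plus S HS), <- linear_minus by (try apply (rs_linear S HS); lra).
    apply HSK. lra.
  - apply negligible_plus; [apply (rs_continuous S HS) | now apply vanishing_scal].
Qed.

(** Since [S (t - s) = S (t - (s + h)) S h], the curve moves only by the defect of [u (s + h)] from
    [S h (u s)], amplified by at most [K]. No differentiability of [S] is involved. *)
Lemma transported_increment (u : R -> V) (a c : V) (s t : R) :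
  0 <= s < t -> little_o (fun h => norm (minus (u (s + h)) (plus (S h (u s)) (scal h a)))) ->
  little_o (fun h => norm (minus (S (t - (s + h)) (u (s + h))) c)
                     - norm (minus (S (t - s) (u s)) c) - h * (K * norm a)).
Proof.
  intros Hs Hu.
  apply negligible_le with
    (fun h => K * norm (minus (u (s + h)) (plus (S h (u s)) (scal h a)))).
  - generalize (at_right_interval (t - s) ltac:(lra)). apply filter_imp. intros h Hh.
    set (z := S (t - s) (u s)). set (w := S (t - (s + h)) (u (s + h))).
    pose proof (norm_le_plus (minus w c) (minus w z) (minus z c) ltac:(vec)).
    set (o := minus (u (s + h)) (plus (S h (u s)) (scal h a)) : V).
    assert (H1 : norm (minus w z) <= K * norm (minus (u (s + h)) (S h (u s)))).
    { unfold z, w. replace (t - s) with (t - (s + h) + h) by ring.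
      rewrite (rs_plus S HS), <- linear_minus by (try apply (rs_linear S HS); lra).
      apply HSK. lra. }
    pose proof (norm_le_plus (minus (u (s + h)) (S h (u s))) o (scal h a)
      ltac:(unfold o; vec)) as H2.
    rewrite norm_scal_real, Rabs_pos_eq in H2 by lra. nra.
  - now apply little_o_scal.
Qed.

Variables (T : R -> V -> V) (D : V -> Prop) (A P : V -> V) (C : R).
Hypothesis HT : real_semigroup T.
Hypothesis HT1 : forall t x, 0 <= t -> norm (T t x) <= norm x.
Hypothesis Hinv : forall t x, 0 <= t -> D x -> D (T t x).
Hypothesis Hdense :
  forall (x : V) eps, 0 < eps -> exists y, D y /\ norm (minus y x) < eps.
Hypothesis HTA : forall x, D x -> derivative_at_0 T x (A x).
Hypothesis HSA : forall x, D x -> derivative_at_0 S x (minus (A x) (P x)).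
Hypothesis HP : forall x y, P (minus x y) = minus (P x) (P y).
Hypothesis HC : 0 <= C.
Hypothesis HPC : forall x, norm (P x) <= C * norm x.

Lemma perturbation_on_domain (x : V) :
  D x -> little_o (fun h => norm (minus (T h x) (plus (S h x) (scal h (P x))))).
Proof.
  intros Hx. eapply negligible_le;
    [| exact (negligible_plus _ _ _ (HTA x Hx) (HSA x Hx))].
  apply filter_forall. intros h. simpl.
  rewrite (norm_minus_sym (S h x)). apply norm_le_plus. vec.
Qed.

(** For [y] in the domain, [S (h - s) (T s y)] runs from [S h y] to [T h y] at speed at most
    [K * norm (P (T s y)) <= K * C * norm y]. Density then extends the bound, [1 + K] being the
    crude constant. *)
Lemma perturbation_lipschitz (h : R) (x : V) :
  0 <= h -> norm (minus (T h x) (S h x)) <= K * C * h * norm x.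
Proof.
  intros Hh. apply (dense_bound D (fun x => minus (T h x) (S h x)) (1 + K)); try easy.
  - intros y z. rewrite !linear_minus by now (apply (rs_linear T HT) || apply (rs_linear S HS)).
    vec.
  - intros y. pose proof (HT1 h y Hh). pose proof (HSK h y Hh).
    pose proof (norm_le_plus (minus (T h y) (S h y)) (T h y) (opp (S h y)) ltac:(vec)) as H1.
    rewrite norm_opp in H1. lra.
  - repeat apply Rmult_le_pos; easy.
  - intros y Hy. set (c := S h y).
    pose proof (dini_nonincreasing
      (fun s => norm (minus (S (h - s) (T s y)) c) + (- (K * C * norm y)) * s) 0 h Hh) as H.
    cbv beta in H. rewrite (rs_zero T HT), !Rminus_0_r, Rminus_diag, (rs_zero S HS) in H.
    fold c in H. rewrite norm_minus_self in H.
    enough (norm (minus (T h y) c) + - (K * C * norm y) * h <= 0 + - (K * C * norm y) * 0) by lra.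
    apply H; clear H; intros s Hs.
    + apply negligible_le with (fun k => norm (minus (S (h - s) (T s y)) c)
        - norm (minus (S (h - (s - k)) (T (s - k) y)) c)).
      * generalize at_right_pos. apply filter_imp. intros k Hk.
        assert (0 <= K * C * norm y)
          by (repeat apply Rmult_le_pos; try easy; apply norm_ge_0). nra.
      * apply (transported_left_continuous (fun s => T s y)); [easy |].
        apply (orbit_left_continuous T h 1); [easy | | easy].
        intros t z Ht. rewrite Rmult_1_l. now apply HT1.
    + set (z := T s y).
      apply negligible_le with (fun k => norm (minus (S (h - (s + k)) (T (s + k) y)) c)
        - norm (minus (S (h - s) z) c) - k * (K * norm (P z))).
      * generalize at_right_pos. apply filter_imp. intros k Hk.
        pose proof (HPC z). pose proof (HT1 s y ltac:(lra)) as Hz. fold z in Hz.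
        assert (K * norm (P z) <= K * (C * norm y)) as HKz; [| clear - HKz Hk; nra].
        apply Rmult_le_compat_l; [easy |].
        apply Rle_trans with (C * norm z); [easy | now apply Rmult_le_compat_l].
      * apply (transported_increment (fun s => T s y)); [easy |].
        eapply negligible_le;
          [| exact (perturbation_on_domain z (Hinv s y ltac:(lra) Hy))].
        generalize at_right_pos. apply filter_imp. intros k Hk.
        rewrite Rplus_comm, (rs_plus T HT) by lra. apply Rle_refl.
Qed.

(** Replacing [x] by a nearby [y] in the domain costs at most [(K * C + C) * h * norm (minus x y)].
    This cost is proportional to [h], so [y] can be fixed before [h] tends to 0. *)
Lemma perturbation (x : V) :
  little_o (fun h => norm (minus (T h x) (plus (S h x) (scal h (P x))))).
Proof.
  intros eps. set (c := K * C + C + 1).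
  assert (HKC : 0 <= K * C) by now apply Rmult_le_pos.
  pose proof (cond_pos eps).
  destruct (Hdense x (eps / 2 / c)) as [y [Hy Hyx]].
  { apply Rdiv_lt_0_compat; unfold c; lra. }
  assert (Hc : norm (minus y x) * c <= eps / 2) by (apply Rle_div_r; unfold c in *; lra).
  generalize (filter_and _ _ at_right_pos (perturbation_on_domain y Hy (pos_div_2 eps))).
  apply filter_imp. simpl. intros h [Hh H1].
  assert (HTh := rs_linear T HT h (Rlt_le _ _ Hh)).
  assert (HSh := rs_linear S HS h (Rlt_le _ _ Hh)).
  pose proof (perturbation_lipschitz h (minus x y) ltac:(lra)) as H2.
  pose proof (HPC (minus x y)) as H3.
  rewrite (norm_minus_sym x y) in H2, H3.
  pose proof (norm_le_plus (minus (T h x) (plus (S h x) (scal h (P x))))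
    (minus (T h y) (plus (S h y) (scal h (P y))))
    (minus (minus (T h (minus x y)) (S h (minus x y))) (scal h (P (minus x y))))
    ltac:(rewrite HP, (linear_minus (T h)), (linear_minus (S h)) by easy; vec)) as H4.
  pose proof (norm_le_plus
    (minus (minus (T h (minus x y)) (S h (minus x y))) (scal h (P (minus x y))))
    (minus (T h (minus x y)) (S h (minus x y))) (scal (Ropp h) (P (minus x y)))
    ltac:(vec)) as H5.
  rewrite norm_scal_real, Rabs_Ropp, Rabs_pos_eq in H5 by lra.
  pose proof (norm_ge_0 (minus y x)).
  assert (h * norm (P (minus x y)) <= h * (C * norm (minus y x)))
    by (apply Rmult_le_compat_l; lra).
  assert (h * (norm (minus y x) * (K * C + C)) <= h * (eps / 2)).
  { apply Rmult_le_compat_l; [lra |]. unfold c in Hc. lra. }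
  lra.
Qed.

End Comparison.

End Semigroup.

(** * Decay along the damped evolution *)

Lemma exp_le_compat (x y : R) : x <= y -> exp x <= exp y.
Proof. intros [H | ->]; [left; now apply exp_increasing | apply Rle_refl]. Qed.

Section Decay.

Context {V : NormedModule R_AbsRing}.

(* The first-order expansion at every time of the solutions of
   [u' = A u - d(t) P u], where [A] generates [T]. *)
Record damped_orbit (T : R -> V -> V) (P : V -> V) (d : R -> R) (u : R -> V) : Prop := {
  orbit_left : forall s, 0 < s -> vanishing (fun h => norm (minus (u s) (u (s - h))));
  orbit_right : forall s, 0 <= s -> little_o (fun h =>
    norm (minus (u (s + h)) (plus (T h (u s)) (scal h (scal (- d s) (P (u s)))))))
}.

Lemma damped_orbit_shift (T : R -> V -> V) (P : V -> V) (d : R -> R) (u : R -> V) (t : R) :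
  0 <= t -> damped_orbit T P d u ->
  damped_orbit T P (fun s => d (t + s)) (fun s => u (t + s)).
Proof.
  intros Ht [Hl Hr]. split; intros s Hs.
  - eapply negligible_le; [| exact (Hl (t + s) ltac:(lra))].
    apply filter_forall. intros h. replace (t + (s - h)) with (t + s - h) by ring.
    apply Rle_refl.
  - eapply negligible_le; [| exact (Hr (t + s) ltac:(lra))].
    apply filter_forall. intros h. rewrite <- Rplus_assoc. apply Rle_refl.
Qed.

Variables (q : V -> V -> R) (S : R -> V -> V) (P : V -> V) (d0 d1 b K beta : R).
Hypothesis Hq : real_inner q.
Hypothesis HS : real_semigroup S.
Hypothesis Hd0 : 0 < d0.
Hypothesis Hd1 : 0 < d1.
Hypothesis Hb : 0 < b.
Hypothesis HK : 0 < K.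
Hypothesis Hbeta : 0 < beta.
Hypothesis HSK : forall x t, 0 <= t -> norm (S t x) <= K * exp (- beta * t) * norm x.
Hypothesis HPb : forall x, norm (P x) ^ 2 <= b * q x (P x).

Lemma stable_bound (t : R) (x : V) : 0 <= t -> norm (S t x) <= K * norm x.
Proof.
  intros Ht. eapply Rle_trans; [now apply HSK |].
  apply Rmult_le_compat_r; [apply norm_ge_0 |].
  rewrite <- (Rmult_1_r K) at 2. apply Rmult_le_compat_l; [lra |].
  rewrite <- exp_0. apply exp_le_compat. nra.
Qed.

Section Orbit.

Variables (T : R -> V -> V) (d : R -> R) (u : R -> V).
Hypothesis HT : real_semigroup T.
Hypothesis HT1 : forall t x, 0 <= t -> norm (T t x) <= norm x.
Hypothesis HTS : forall x,
  little_o (fun h => norm (minus (T h x) (plus (S h x) (scal h (scal d0 (P x)))))).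
Hypothesis Hd : forall t, 0 <= t -> d0 <= d t <= d1.
Hypothesis Hu : damped_orbit T P d u.

(** The expansion is based at [T h (u s)], whose norm is at most that of [u s]; what remains is
    [- 2 d(s) q(u, P u)], bounded through [HPb] and [d0 <= d s]. *)
Lemma energy_increment (s : R) :
  0 <= s -> little_o (fun h =>
    norm (u (s + h)) ^ 2 - norm (u s) ^ 2 - h * (- (2 * d0 / b) * norm (P (u s)) ^ 2)).
Proof.
  intros Hs. set (a := scal (- d s) (P (u s)) : V).
  eapply negligible_le;
    [| exact (sqr_norm_increment q Hq (u s) a (fun h => T h (u s)) (fun h => u (s + h))
         (rs_continuous T HT (u s)) (orbit_right T P d u Hu s Hs))].
  generalize at_right_pos. apply filter_imp. intros h Hh.
  assert (norm (T h (u s)) ^ 2 <= norm (u s) ^ 2).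
  { apply pow_incr. split; [apply norm_ge_0 | apply HT1; lra]. }
  unfold a. rewrite (inner_scal_r q Hq).
  pose proof (HPb (u s)) as H1. pose proof (Hd s Hs) as H2.
  set (p := norm (P (u s)) ^ 2) in *. set (e := q (u s) (P (u s))) in *.
  assert (Hp : 0 <= p) by apply pow2_ge_0.
  assert (H3 : p / b <= e) by (apply Rle_div_l; lra).
  assert (0 <= p / b) by (apply Rdiv_le_0_compat; lra).
  replace (- (2 * d0 / b) * p) with (- (2 * d0 * (p / b))) by (field; lra).
  assert (d0 * (p / b) <= d s * e) by (apply Rmult_le_compat; lra).
  nra.
Qed.

Lemma energy_nonincreasing (t : R) : 0 <= t -> norm (u t) <= norm (u 0).
Proof.
  intros Ht. apply Rsqr_incr_0; try apply norm_ge_0. rewrite !Rsqr_pow2.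
  apply (dini_nonincreasing (fun s => norm (u s) ^ 2)); [easy | |]; intros s Hs.
  - apply sqr_norm_left_continuous. apply (orbit_left T P d u Hu). lra.
  - eapply negligible_le; [| exact (energy_increment s ltac:(lra))].
    generalize at_right_pos. apply filter_imp. intros h Hh.
    assert (0 <= 2 * d0 / b * norm (P (u s)) ^ 2); [| nra].
    apply Rmult_le_pos; [apply Rdiv_le_0_compat; lra | apply pow2_ge_0].
Qed.

Lemma stable_increment (s : R) :
  0 <= s -> little_o (fun h =>
    norm (minus (u (s + h)) (plus (S h (u s)) (scal h (scal (d0 - d s) (P (u s))))))).
Proof.
  intros Hs.
  eapply negligible_le;
    [| exact (negligible_plus _ _ _ (orbit_right T P d u Hu s Hs) (HTS (u s)))].
  apply filter_forall. intros h. apply norm_le_plus. vec.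
Qed.

(* Let [c s = K * d1 * norm (P (u s))]. The distance between [u] and the stable
   orbit grows at rate at most [c], which by AM-GM is at most
   [K * d1 * (norm (P (u s)) ^ 2 / (2 * lambda) + lambda / 2)]; the first term is
   paid for by the energy. *)
Lemma distance_to_stable_orbit (tau lambda : R) :
  0 <= tau -> 0 < lambda ->
  norm (minus (u tau) (S tau (u 0))) <=
    K * d1 * b / (4 * d0 * lambda) * (norm (u 0) ^ 2 - norm (u tau) ^ 2)
    + K * d1 * lambda / 2 * tau.
Proof.
  intros Htau Hl. set (z := S tau (u 0)).
  set (L := K * d1). assert (HL : 0 < L) by now apply Rmult_lt_0_compat.
  (* Weight of the energy for which its dissipation [c * (2 * d0 / b) * p ^ 2] equals the AM-GM term
     [L * p ^ 2 / (2 * lambda)]. *)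
  set (c := L * b / (4 * d0 * lambda)).
  assert (Hc : 0 < c).
  { unfold c. apply Rdiv_lt_0_compat; repeat apply Rmult_lt_0_compat; lra. }
  pose proof (dini_nonincreasing (fun s => norm (minus (S (tau - s) (u s)) z)
    + (c * norm (u s) ^ 2 + - (L * lambda / 2) * s)) 0 tau Htau) as H.
  cbv beta in H. rewrite Rminus_diag, (rs_zero S HS), Rminus_0_r in H. fold z in H.
  rewrite norm_minus_self in H.
  cut (norm (minus (u tau) z) + (c * norm (u tau) ^ 2 + - (L * lambda / 2) * tau)
    <= 0 + (c * norm (u 0) ^ 2 + - (L * lambda / 2) * 0)); [lra |].
  apply H; clear H; intros s Hs.
  - assert (Hus := orbit_left T P d u Hu s ltac:(lra)).
    eapply negligible_le; [| exact (negligible_plus _ _ _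
      (transported_left_continuous S K HS ltac:(lra) stable_bound u z s tau Hs Hus)
      (vanishing_scal _ c (Rlt_le _ _ Hc) (sqr_norm_left_continuous u s Hus)))].
    generalize at_right_pos. apply filter_imp. intros h Hh. cbv beta.
    assert (0 < L * lambda / 2 * h); [| lra].
    apply Rmult_lt_0_compat; [| easy].
    apply Rdiv_lt_0_compat; [apply Rmult_lt_0_compat |]; lra.
  - eapply negligible_le; [| exact (negligible_plus _ _ _
      (transported_increment S K HS ltac:(lra) stable_bound u _ z s tau Hs
         (stable_increment s ltac:(lra)))
      (little_o_scal _ c (Rlt_le _ _ Hc) (energy_increment s ltac:(lra))))].
    generalize at_right_pos. apply filter_imp. intros h Hh. cbv beta.
    rewrite norm_scal_real. set (p := norm (P (u s))).
    assert (Hp : 0 <= p) by apply norm_ge_0.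
    assert (Hrate : K * (Rabs (d0 - d s) * p) <= L * p).
    { unfold L. rewrite Rmult_assoc. apply Rmult_le_compat_l; [lra |].
      apply Rmult_le_compat_r; [easy |]. pose proof (Hd s ltac:(lra)).
      apply Rabs_le. lra. }
    assert (Hcp : c * (2 * d0 / b * p ^ 2) = L * (p ^ 2 / (2 * lambda)))
      by (unfold c; field; lra).
    assert (Hamgm : p <= p ^ 2 / (2 * lambda) + lambda / 2).
    { apply Rminus_le.
      replace (p - (p ^ 2 / (2 * lambda) + lambda / 2))
        with (- ((p - lambda) ^ 2 / (2 * lambda))) by (field; lra).
      pose proof (Rdiv_le_0_compat _ (2 * lambda) (pow2_ge_0 (p - lambda)) ltac:(lra)).
      lra. }
    assert (h * (K * (Rabs (d0 - d s) * p)) <=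
      h * (L * (p ^ 2 / (2 * lambda) + lambda / 2))).
    { apply Rmult_le_compat_l; [lra |]. eapply Rle_trans; [exact Hrate |].
      apply Rmult_le_compat_l; lra. }
    replace (c * (norm (u (s + h)) ^ 2 - norm (u s) ^ 2 - h * (- (2 * d0 / b) * p ^ 2)))
      with (c * norm (u (s + h)) ^ 2 - c * norm (u s) ^ 2 + h * (c * (2 * d0 / b * p ^ 2)))
      by ring.
    rewrite Hcp. lra.
Qed.

(** With [x] and [y] the final and initial norms, the distance estimate contributes
    [E * (y - x) + y / 8] and the stable semigroup [y / 2]. Moving [E * x] to the left leaves a
    factor below 1 because [5 / 8 < 1]. *)
Lemma window_contraction (tau : R) :
  0 < tau -> K * exp (- beta * tau) <= 1 / 2 ->
  let E := 2 * (K * d1 * b / (4 * d0)) * (4 * (K * d1) * tau) in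
  norm (u tau) <= (5 / 8 + E) / (1 + E) * norm (u 0).
Proof.
  intros Htau Hexp E.
  set (L := K * d1) in *. assert (HL : 0 < L) by now apply Rmult_lt_0_compat.
  assert (HE : 0 < E).
  { unfold E. repeat (apply Rdiv_lt_0_compat || apply Rmult_lt_0_compat); lra. }
  set (x := norm (u tau)). set (y := norm (u 0)).
  assert (Hx : 0 <= x) by apply norm_ge_0.
  assert (Hxy : x <= y) by (apply energy_nonincreasing; lra).
  enough (x * (1 + E) <= (5 / 8 + E) * y).
  { replace ((5 / 8 + E) / (1 + E) * y) with ((5 / 8 + E) * y / (1 + E)) by (field; lra).
    apply Rle_div_r; lra. }
  destruct (Req_dec y 0) as [Hy | Hy]; [replace x with 0 by lra; rewrite Hy; lra |].
  (* This [lambda] turns [L * lambda / 2 * tau] into [y / 8]; being proportional to [y], it makes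
     the quadratic energy term homogeneous of degree 1. The case [y = 0] had to be removed first. *)
  assert (Hlambda : 0 < y / (4 * L * tau)).
  { apply Rdiv_lt_0_compat; [lra |]. repeat apply Rmult_lt_0_compat; lra. }
  pose proof (distance_to_stable_orbit tau _ (Rlt_le _ _ Htau) Hlambda) as H.
  fold L x y in H.
  pose proof (norm_le_plus (u tau) (minus (u tau) (S tau (u 0))) (S tau (u 0))
    ltac:(vec)) as H1. fold x in H1.
  pose proof (HSK (u 0) tau (Rlt_le _ _ Htau)) as H2. fold y in H2.
  assert (H3 : K * exp (- beta * tau) * y <= 1 / 2 * y) by (apply Rmult_le_compat_r; lra).
  replace (L * b / (4 * d0 * (y / (4 * L * tau))) * (y ^ 2 - x ^ 2))
    with (E * (y - x) * ((y + x) / (2 * y))) in H by (unfold E; field; lra).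
  replace (L * (y / (4 * L * tau)) / 2 * tau) with (y / 8) in H by (field; lra).
  assert (H4 : (y + x) / (2 * y) <= 1) by (apply Rle_div_l; lra).
  assert (0 <= E * (y - x)) by (apply Rmult_le_pos; lra).
  assert (E * (y - x) * ((y + x) / (2 * y)) <= E * (y - x) * 1)
    by (apply Rmult_le_compat_l; easy).
  lra.
Qed.

End Orbit.

(** A time shift preserves the bounds on the damping, so the window estimate iterates. The constants
    precede [T], [d] and [u], hence serve all solutions at once. *)
Lemma damped_orbit_decay :
  exists K' beta', 0 < K' /\ 0 < beta' /\
    forall (T : R -> V -> V) (d : R -> R) (u : R -> V),
    real_semigroup T ->
    (forall t x, 0 <= t -> norm (T t x) <= norm x) ->
    (forall x,
      little_o (fun h => norm (minus (T h x) (plus (S h x) (scal h (scal d0 (P x))))))) ->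
    (forall t, 0 <= t -> d0 <= d t <= d1) ->
    damped_orbit T P d u ->
    forall t, 0 <= t -> norm (u t) <= K' * exp (- beta' * t) * norm (u 0).
Proof.
  assert (Htau : exists tau, 0 < tau /\ K * exp (- beta * tau) <= 1 / 2).
  (* Here [K * exp (- (2 * K)) <= K / (1 + 2 * K) <= 1 / 2]. *)
  { exists (2 * K / beta). split; [apply Rdiv_lt_0_compat; lra |].
    replace (- beta * (2 * K / beta)) with (- (2 * K)) by (field; lra).
    rewrite exp_Ropp. pose proof (exp_ineq1 (2 * K) ltac:(lra)).
    apply Rle_div_l; lra. }
  destruct Htau as [tau [Htau Hexp]].
  set (E := 2 * (K * d1 * b / (4 * d0)) * (4 * (K * d1) * tau)).
  assert (HE : 0 < E).
  { unfold E. repeat (apply Rdiv_lt_0_compat || apply Rmult_lt_0_compat); lra. }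
  set (gamma := (5 / 8 + E) / (1 + E)).
  assert (Hg : 0 < gamma) by (apply Rdiv_lt_0_compat; lra).
  assert (Hg1 : gamma < 1) by (apply Rlt_div_l; lra).
  assert (Hln : ln gamma < 0) by (rewrite <- ln_1; now apply ln_increasing).
  (* The rate is that of [gamma ^ (t / tau)]; the factor [/ gamma] pays for the incomplete last
     window, on which the norm is merely nonincreasing. *)
  exists (/ gamma), (- ln gamma / tau).
  split; [now apply Rinv_0_lt_compat |]. split; [apply Rdiv_lt_0_compat; lra |].
  intros T d u HT HT1 HTS Hd Hu.
  assert (Hn : forall n, norm (u (INR n * tau)) <= gamma ^ n * norm (u 0)).
  { induction n as [| n IH]; [simpl; rewrite !Rmult_0_l; lra |].
    assert (H0 : 0 <= INR n * tau) by (apply Rmult_le_pos; [apply pos_INR | lra]).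
    pose proof (window_contraction T _ _ HT HT1 HTS
      (fun s Hs => Hd (INR n * tau + s) (Rplus_le_le_0_compat _ _ H0 Hs))
      (damped_orbit_shift T P d u _ H0 Hu) tau Htau Hexp) as H.
    cbv beta zeta in H. fold E in H. fold gamma in H. rewrite Rplus_0_r in H.
    rewrite S_INR, Rmult_plus_distr_r, Rmult_1_l.
    eapply Rle_trans; [exact H |]. simpl. rewrite Rmult_assoc.
    apply Rmult_le_compat_l; lra. }
  intros t Ht.
  destruct (nfloor_ex (t / tau)) as [n [Hn1 Hn2]]; [apply Rdiv_le_0_compat; lra |].
  assert (H0 : 0 <= INR n * tau) by (apply Rmult_le_pos; [apply pos_INR | lra]).
  assert (H1 : INR n * tau <= t) by (apply Rle_div_r; lra).
  pose proof (energy_nonincreasing T _ _ HT HT1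
    (fun s Hs => Hd (INR n * tau + s) (Rplus_le_le_0_compat _ _ H0 Hs))
    (damped_orbit_shift T P d u _ H0 Hu) (t - INR n * tau) ltac:(lra)) as H.
  simpl in H. rewrite Rplus_0_r in H.
  replace (INR n * tau + (t - INR n * tau)) with t in H by ring.
  apply Rle_trans with (gamma ^ n * norm (u 0)); [eapply Rle_trans; [exact H | apply Hn] |].
  apply Rmult_le_compat_r; [apply norm_ge_0 |].
  rewrite <- (exp_ln (/ gamma)) by now apply Rinv_0_lt_compat.
  rewrite ln_Rinv by easy. rewrite <- exp_plus, <- Rpower_pow by easy.
  unfold Rpower. apply exp_le_compat.
  replace (- ln gamma + - (- ln gamma / tau) * t) with ((t / tau - 1) * ln gamma)
    by (field; lra).
  nra.
Qed.

End Decay.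

(** * Mild solutions *)

Section Mild.

Context {V : CompleteNormedModule R_AbsRing}.

Lemma is_RInt_linear (L : V -> V) (f : R -> V) (a b : R) (l : V) :
  is_linear L -> is_RInt f a b l -> is_RInt (fun x => L (f x)) a b (L l).
Proof.
  intros HL Hf. unfold is_RInt in *.
  apply filterlim_ext with (fun ptd => L (scal (sign (b - a)) (Riemann_sum f ptd))).
  - intros ptd. rewrite (linear_scal L HL). f_equal.
    induction ptd as [x0 | p ptd IH] using SF_cons_ind.
    + apply (linear_zero L HL).
    + rewrite !Riemann_sum_cons, <- IH, (linear_plus L HL), (linear_scal L HL).
      reflexivity.
  - eapply filterlim_comp; [exact Hf |]. apply (linear_cont L l HL).
Qed.

(** By the semigroup law [v (s + h) - T h (v s)] is the integral of [T (s + h - r) (f r)] over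
    [[s, s + h]]. The integrand is uniformly close to [f s], since [T] is contractive and [f] is
    right continuous at [s]. *)
Lemma mild_increment (T : R -> V -> V) (f v : R -> V) (s : R) :
  real_semigroup T -> (forall t x, 0 <= t -> norm (T t x) <= norm x) ->
  (forall t, 0 <= t -> is_RInt (fun r => T (t - r) (f r)) 0 t (minus (v t) (T t (v 0)))) ->
  0 <= s -> vanishing (fun h => norm (minus (f (s + h)) (f s))) ->
  little_o (fun h => norm (minus (v (s + h)) (plus (T h (v s)) (scal h (f s))))).
Proof.
  intros HT HT1 Hv Hs Hf eps.
  destruct (at_right_elim _ 1 Rlt_0_1
    (filter_and _ _ (Hf (pos_div_2 eps)) (rs_continuous T HT (f s) (pos_div_2 eps))))
    as [b [Hb H]]. simpl in H.
  pose proof (cond_pos eps) as Heps.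
  generalize (at_right_interval b (proj1 Hb)). apply filter_imp. intros h Hh.
  assert (HTh := rs_linear T HT h ltac:(lra)).
  set (g r := T (s + h - r) (f r)).
  assert (H1 : is_RInt g 0 s (T h (minus (v s) (T s (v 0))))).
  { apply (is_RInt_ext (fun r => T h (T (s - r) (f r)))).
    - intros r Hr. rewrite Rmin_left, Rmax_right in Hr by lra. unfold g.
      rewrite <- (rs_plus T HT) by lra. f_equal. ring.
    - apply is_RInt_linear; [easy |]. now apply Hv. }
  destruct (ex_RInt_Chasles_2 g 0 s (s + h) ltac:(lra)
    (ex_intro _ _ (Hv (s + h) ltac:(lra)))) as [I2 H2].
  pose proof (is_RInt_Chasles g 0 s (s + h) _ _ H1 H2) as H3.
  apply is_RInt_unique in H3.
  pose proof (is_RInt_unique _ _ _ _ (Hv (s + h) ltac:(lra))) as H4.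
  fold g in H4. rewrite H3 in H4. clear H3.
  rewrite (linear_minus (T h)), <- (rs_plus T HT), (Rplus_comm h) in H4 by (easy || lra).
  pose proof (is_RInt_minus g (fun _ => f s) s (s + h) _ _ H2 (is_RInt_const s (s + h) (f s)))
    as H5.
  replace (s + h - s) with h in H5 by ring.
  assert (E : minus (v (s + h)) (plus (T h (v s)) (scal h (f s))) = minus I2 (scal h (f s))).
  { transitivity (minus (minus (v (s + h)) (T (s + h) (v 0)))
      (plus (minus (T h (v s)) (T (s + h) (v 0))) (scal h (f s)))); [vec |].
    rewrite <- H4. vec. }
  rewrite E.
  replace (eps * h) with ((s + h - s) * eps) by ring.
  refine (norm_RInt_le_const _ s (s + h) _ eps _ _ H5); [lra |].
  intros r Hr. unfold g.
  assert (HL := rs_linear T HT (s + h - r) ltac:(lra)).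
  assert (Hf' : norm (minus (f r) (f s)) <= eps / 2).
  { destruct (Rle_lt_or_eq_dec s r (proj1 Hr)) as [Hsr | <-].
    - replace r with (s + (r - s)) by ring. rewrite <- Rmult_1_r. apply H. lra.
    - eapply Rle_trans; [right; apply (norm_minus_self (V := V)) | lra]. }
  assert (HT' : norm (minus (T (s + h - r) (f s)) (f s)) <= eps / 2).
  { destruct (Rle_lt_or_eq_dec r (s + h) (proj2 Hr)) as [Hsr | ->].
    - rewrite <- Rmult_1_r. apply H. lra.
    - rewrite Rminus_diag, (rs_zero T HT).
      eapply Rle_trans; [right; apply (norm_minus_self (V := V)) | lra]. }
  assert (H6 : norm (minus (T (s + h - r) (f r)) (T (s + h - r) (f s))) <= eps / 2).
  { apply Rle_trans with (norm (minus (f r) (f s))); [| exact Hf'].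
    eapply Rle_trans; [| apply (HT1 (s + h - r)); lra].
    right. f_equal. symmetry. exact (linear_minus _ (f r) (f s) HL). }
  pose proof (norm_le_plus (minus (T (s + h - r) (f r)) (f s))
    (minus (T (s + h - r) (f r)) (T (s + h - r) (f s)))
    (minus (T (s + h - r) (f s)) (f s)) ltac:(vec)) as H7.
  replace (pos eps) with (eps / 2 + eps / 2) by field.
  eapply Rle_trans; [exact H7 | apply Rplus_le_compat; [exact H6 | exact HT']].
Qed.

End Mild.

(** * Restriction of scalars *)

Section Restriction.

Context {k : scalar_field}.

Lemma re_of_R (a : R) : re (@of_R k a) = a.
Proof. now destruct k. Qed.

Lemma re_plus (a b : scalars k) : re (plus a b) = re a + re b.
Proof. now destruct k. Qed.

Lemma re_of_R_mult (a : R) (z : scalars k) : re (mult (of_R a) z) = a * re z.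
Proof. destruct k; [easy |]. destruct z. unfold mult. simpl. ring. Qed.

Lemma re_conj (z : scalars k) : re (conj z) = re z.
Proof. now destruct k. Qed.

(** Multipliers 1 and [i] recover both components; this lifts identities between real parts to
    scalar ones. *)
Lemma scalars_ext (z w : scalars k) :
  (forall a : scalars k, re (mult a z) = re (mult a w)) -> z = w.
Proof.
  destruct k; simpl in *; intros H.
  - specialize (H 1). unfold mult in H. simpl in H. lra.
  - pose proof (H (RtoC 1)) as H1. specialize (H Ci). destruct z, w.
    unfold mult in *. simpl in *. f_equal; lra.
Qed.

Definition real_ip (H : Hilbert k) (x y : restrict_scalars H) : R := re (ip H x y).

Lemma real_ip_inner (H : Hilbert k) : real_inner (real_ip H).
Proof.
  split; unfold real_ip.
  - intros x y z. rewrite <- re_plus. f_equal. apply ip_plus.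
  - intros a x z. rewrite <- re_of_R_mult. f_equal. apply ip_scal.
  - intros x y. rewrite (ip_conj k H x y). symmetry. apply re_conj.
  - intros x. rewrite ip_norm. apply re_of_R.
Qed.

Lemma restrict_linear (H : Hilbert k) (L : H -> H) :
  is_linear L -> @is_linear R_AbsRing (restrict_scalars H) (restrict_scalars H) L.
Proof.
  intros [Hp Hs Hn]. split; [exact Hp | | exact Hn].
  intros a x. exact (Hs (of_R a) x).
Qed.

Lemma filterlim_norm_minus (H : Hilbert k) (F : (R -> Prop) -> Prop) (f : R -> H) (y : H) :
  Filter F ->
  filterlim f F (locally y) <->
  forall eps : posreal, F (fun x => @norm R_AbsRing (restrict_scalars H)
    (@minus (restrict_scalars H) (f x) y) < eps).
Proof.
  intros HF. exact (filterlim_locally_ball_norm (U := restrict_scalars H) f y).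
Qed.

Lemma restrict_semigroup (H : Hilbert k) (T : R -> H -> H) :
  C0_semigroup T -> @real_semigroup (restrict_scalars H) T.
Proof.
  intros [Hl H0 Hp Hc]. split; try easy.
  - intros t Ht. now apply restrict_linear, Hl.
  - intros x eps. generalize (proj1 (filterlim_norm_minus H _ _ x _) (Hc x) eps).
    apply filter_imp. intros h Hh. rewrite Rmult_1_r. left. exact Hh.
Qed.

Lemma restrict_derivative (H : Hilbert k) (T : R -> H -> H) (x y : H) :
  filterlim (fun h => scal (of_R (/ h)) (minus (T h x) x)) (at_right 0) (locally y) <->
  @derivative_at_0 (restrict_scalars H) T x y.
Proof.
  refine (iff_trans (filterlim_norm_minus H _ _ y _) _).
  exact (derivative_at_0_quotient (V := restrict_scalars H) T x y).
Qed.

Lemma restrict_generates (H : Hilbert k) (G : operator H H) (T : R -> H -> H) :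
  generates G T ->
  @real_semigroup (restrict_scalars H) T /\
  forall x y, (dom G x /\ G x = y) <-> @derivative_at_0 (restrict_scalars H) T x y.
Proof.
  intros [HT HG]. split; [now apply restrict_semigroup |].
  intros x y. rewrite HG. apply restrict_derivative.
Qed.

Lemma restrict_dense (H : Hilbert k) (G : operator H H) :
  densely_defined G ->
  forall (x : restrict_scalars H) eps, 0 < eps ->
    exists y : restrict_scalars H, dom G y /\ norm (minus y x) < eps.
Proof.
  intros HG x eps Heps.
  pose proof (@norm_factor_gt_0 _ (restrict_scalars H)) as Hf.
  set (c := @norm_factor _ (restrict_scalars H)) in *.
  (* Balls and norms agree only up to [norm_factor], hence the radius [eps / c]. *)
  destruct (HG x (mkposreal _ (Rdiv_lt_0_compat _ _ Heps Hf))) as [y [Hy Hb]].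
  exists y. split; [easy |].
  replace eps with (c * (eps / c)) by (field; lra).
  exact (norm_compat2 (V := restrict_scalars H) x y
    (mkposreal _ (Rdiv_lt_0_compat _ _ Heps Hf)) Hb).
Qed.

Section Damping.

Variables (H U : Hilbert k) (B : U -> H) (M : R).
Hypothesis HB : is_linear B.
Hypothesis HM : 0 < M.
Hypothesis HBM : forall u, norm (B u) <= M * norm u.

(** Riesz in the real space [U] represents only the real part of [ip H (B u) x]; testing with all
    multiples [scal a u] recovers the full scalar identity. *)
Lemma adjoint_exists (x : H) : exists z, adjoint_at (total B) x z.
Proof.
  set (V := restrict_scalars H). set (W := restrict_scalars U).
  destruct (riesz (real_ip U) (real_ip_inner U)
    (fun u => real_ip H (B u) x) (@norm R_AbsRing V x * M)) as [z Hz].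
  - apply complete_norm_complete.
  - intros u w. unfold real_ip. rewrite <- re_plus, <- ip_plus. do 2 f_equal.
    apply (linear_plus B HB).
  - intros a u. unfold real_ip. rewrite <- re_of_R_mult, <- ip_scal. do 2 f_equal.
    apply (linear_scal B HB).
  - intros u.
    eapply Rle_trans; [exact (Rabs_inner_le (real_ip H) (real_ip_inner H) (B u) x) |].
    rewrite Rmult_comm, Rmult_assoc. apply Rmult_le_compat_l; [apply norm_ge_0 | apply HBM].
  - exists z. intros u _. apply scalars_ext. intros a.
    rewrite <- !ip_scal. simpl. rewrite <- (linear_scal B HB). exact (Hz (scal a u)).
Qed.

Lemma adjoint_spec (x : H) (u : U) : ip H (B u) x = ip U u (adjoint (total B) x).
Proof.
  exact (epsilon_spec (inhabits zero) (adjoint_at (total B) x) (adjoint_exists x) u I).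
Qed.

(** The adjoint is a choice by [epsilon], so its additivity has to come from uniqueness of the
    representing vector. *)
Lemma damping_minus (x y : H) :
  damping B (minus x y) = minus (damping B x) (damping B y).
Proof.
  assert (Hspec : forall (u : U) (w : H),
    real_ip U u (adjoint (total B) w) = real_ip H (B u) w).
  { intros u w. unfold real_ip. now rewrite adjoint_spec. }
  set (zx := adjoint (total B) x : U). set (zy := adjoint (total B) y : U).
  assert (E : adjoint (total B) (minus x y) = minus zx zy).
  { apply (inner_separates (V := restrict_scalars U) (real_ip U) (real_ip_inner U)).
    intros u. rewrite Hspec.
    etransitivity; [exact (inner_minus_r _ (real_ip_inner H) (B u) x y) |].
    rewrite <- !Hspec. symmetry.
    exact (inner_minus_r _ (real_ip_inner U) u zx zy). }
  unfold damping. rewrite E. unfold minus. rewrite (linear_plus B HB). f_equal.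
  refine (eq_trans _ (scal_opp_one (B zy))). rewrite <- (linear_scal B HB). f_equal.
  symmetry. apply (scal_opp_one zy).
Qed.

Lemma damping_energy (x : restrict_scalars H) :
  @norm R_AbsRing (restrict_scalars H) (damping B x) ^ 2
  <= M ^ 2 * real_ip H x (damping B x).
Proof.
  rewrite (inner_sym _ (real_ip_inner H)). unfold damping. set (z := adjoint (total B) x).
  assert (E : real_ip H (B z) x = @norm R_AbsRing (restrict_scalars U) z ^ 2).
  { rewrite <- (inner_norm _ (real_ip_inner U)). unfold real_ip. now rewrite adjoint_spec. }
  rewrite E, <- Rpow_mult_distr. apply pow_incr. split; [apply norm_ge_0 | apply HBM].
Qed.

(** With [p = damping B x], the energy inequality and Cauchy-Schwarz give
    [norm p ^ 2 <= M ^ 2 * norm x * norm p]; divide by [norm p] unless it is 0. *)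
Lemma damping_bound (x : restrict_scalars H) :
  @norm R_AbsRing (restrict_scalars H) (damping B x) <= M ^ 2 * norm x.
Proof.
  pose proof (damping_energy x) as H1.
  set (p := damping B x : restrict_scalars H) in *.
  pose proof (inner_le_norm _ (real_ip_inner H) x p) as H2.
  change (@norm R_AbsRing (restrict_scalars H) (damping B x)) with (norm p) in *.
  pose proof (norm_ge_0 p) as Hp. pose proof (norm_ge_0 x).
  assert (HM2 : 0 < M ^ 2) by now apply pow_lt.
  destruct (Rle_lt_or_eq_dec 0 (norm p) Hp) as [Hp' | <-].
  - apply Rmult_le_reg_r with (norm p); [easy |].
    assert (M ^ 2 * real_ip H x p <= M ^ 2 * (norm x * norm p))
      by (apply Rmult_le_compat_l; lra). nra.
  - apply Rmult_le_pos; lra.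
Qed.

End Damping.

End Restriction.

Lemma within_vanishing (r : R -> R) (s : R) :
  0 <= s ->
  (forall eps : posreal, within (fun t => 0 <= t) (locally s) (fun t => r t < eps)) ->
  vanishing (fun h => r (s + h)) /\ (0 < s -> vanishing (fun h => r (s - h))).
Proof.
  intros Hs Hr. split; [| intros Hs']; intros eps; destruct (Hr eps) as [delta Hdelta].
  - generalize (at_right_interval delta (cond_pos delta)). apply filter_imp.
    intros h Hh. rewrite Rmult_1_r. left. apply Hdelta; [| lra].
    apply Rabs_def1; unfold minus, plus, opp; simpl; lra.
  - pose proof (Rmin_pos s delta Hs' (cond_pos delta)) as Hmin.
    generalize (at_right_interval _ Hmin). apply filter_imp.
    intros h Hh. pose proof (Rmin_l s delta). pose proof (Rmin_r s delta).
    rewrite Rmult_1_r. left. apply Hdelta; [| lra].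
    apply Rabs_def1; unfold minus, plus, opp; simpl; lra.
Qed.

Lemma control_right_continuous {V : NormedModule R_AbsRing} (P : V -> V) (C d1 : R)
    (d : R -> R) (v : R -> V) (s : R) :
  (forall x y, P (minus x y) = minus (P x) (P y)) ->
  (forall x, norm (P x) <= C * norm x) -> 0 <= C -> 0 < d1 ->
  (forall t, 0 <= t -> Rabs (d t) <= d1) -> 0 <= s ->
  vanishing (fun h => Rabs (d (s + h) - d s)) ->
  vanishing (fun h => norm (minus (v (s + h)) (v s))) ->
  vanishing (fun h => norm (minus (opp (scal (d (s + h)) (P (v (s + h)))))
                                  (opp (scal (d s) (P (v s)))))).
Proof.
  intros HP HPC HC Hd1 Hd Hs Hdc Hvc.
  eapply negligible_le; [| exact (negligible_plus _ _ _
    (vanishing_scal _ (norm (P (v s))) (norm_ge_0 _) Hdc)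
    (vanishing_scal _ (d1 * C) (Rmult_le_pos _ _ (Rlt_le _ _ Hd1) HC) Hvc))].
  generalize at_right_pos. apply filter_imp. intros h Hh.
  set (o := minus (opp (scal (d (s + h)) (P (v (s + h))))) (opp (scal (d s) (P (v s)))) : V).
  pose proof (norm_le_plus o (scal (- (d (s + h) - d s)) (P (v s)))
    (scal (- d (s + h)) (P (minus (v (s + h)) (v s)))) ltac:(unfold o; rewrite HP; vec)) as H.
  rewrite !norm_scal_real, !Rabs_Ropp in H.
  assert (H2 : Rabs (d (s + h)) * norm (P (minus (v (s + h)) (v s)))
    <= d1 * (C * norm (minus (v (s + h)) (v s)))).
  { apply Rmult_le_compat; try apply Rabs_pos; try apply norm_ge_0; [| apply HPC].
    apply Hd. lra. }
  lra.
Qed.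

Lemma mild_damped_orbit {k : scalar_field} {H U : Hilbert k} (A : operator H H)
    (B : U -> H) (d : R -> R) (d0 d1 : R) (T : R -> H -> H) (v0 : H) (v : R -> H) :
  is_linear B -> continuous_on (fun t => 0 <= t) d -> 0 < d0 -> 0 < d1 ->
  (forall t, 0 <= t -> d0 <= d t <= d1) ->
  @real_semigroup (restrict_scalars H) T ->
  (forall t (x : restrict_scalars H), 0 <= t ->
    @norm _ (restrict_scalars H) (T t x) <= norm x) ->
  continuous_on (fun t => 0 <= t) v ->
  (forall t, 0 <= t ->
    is_RInt (V := restrict_scalars H)
      (fun s => T (t - s) (opp (scal (of_R (d s)) (damping B (v s)))))
      0 t (minus (v t) (T t v0))) ->
  v 0 = v0 /\ @damped_orbit (restrict_scalars H) T (damping B) d v.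
Proof.
  intros HB Hdc Hd0 Hd1 Hd HT HT1 Hvc Hv.
  destruct (linear_norm B HB) as [M [HM HBM]].
  set (V := restrict_scalars H) in *.
  assert (E : v 0 = v0).
  (* The initial value is encoded in the mild formula at [t = 0], where the integral is zero and
     [T 0] is the identity. *)
  { pose proof (is_RInt_unique _ _ _ _ (Hv 0 (Rle_refl 0))) as E.
    rewrite (is_RInt_unique (V := V) _ _ _ _ (is_RInt_point _ _)) in E.
    rewrite (rs_zero (V := V) T HT) in E.
    set (a := v 0 : V) in *. set (b := v0 : V) in *.
    change (@zero V = minus a b) in E. change (a = b).
    transitivity (plus b (minus a b)); [vec | rewrite <- E; vec]. }
  split; [exact E |]. subst v0.
  assert (Hvs : forall s, 0 <= s ->
    vanishing (fun h => @norm _ V (@minus V (v (s + h)) (v s))) /\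
    (0 < s -> vanishing (fun h => @norm _ V (@minus V (v (s - h)) (v s))))).
  { intros s Hs. apply (within_vanishing (fun t => @norm _ V (@minus V (v t) (v s)))); [easy |].
    exact (proj1 (filterlim_norm_minus H _ v (v s) _) (Hvc s Hs)). }
  split.
  - intros s Hs. eapply negligible_le; [| exact (proj2 (Hvs s (Rlt_le _ _ Hs)) Hs)].
    apply filter_forall. intros h. right. apply (norm_minus_sym (V := V)).
  - intros s Hs.
    assert (Hds : vanishing (fun h => Rabs (d (s + h) - d s))).
    { apply (within_vanishing (fun t => Rabs (d t - d s)) s Hs).
      exact (proj1 (filterlim_locally_ball_norm (U := R_NormedModule) _ _) (Hdc s Hs)). }
    eapply negligible_le; [| exact (mild_increment (V := V) T
      (fun s => @opp V (@scal _ V (d s) (damping B (v s)))) v s HT HT1 Hv Hs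
      (control_right_continuous (V := V) (damping B) (M ^ 2) d1 d v s
        (damping_minus H U B M HB HBM) (damping_bound H U B M HB HM HBM)
        (pow_le _ 2 (Rlt_le _ _ HM)) Hd1
        ltac:(intros t Ht; specialize (Hd t Ht); apply Rabs_le; lra) Hs Hds
        (proj1 (Hvs s Hs))))].
    apply filter_forall. intros h. right. f_equal.
    set (p := damping B (v s) : V). set (a := v (s + h) : V). set (b := T h (v s) : V).
    change (minus a (plus b (scal h (scal (- d s) p)))
      = minus a (plus b (scal h (opp (scal (d s) p))))). vec.
Qed.

Theorem theorem3 :
  forall (k : scalar_field) (H U : Hilbert k)
    (A : operator H H) (B : U -> H) (d : R -> R) (d0 d1 : R),
  linear_operator A ->
  densely_defined A ->
  closed_operator A ->
  dissipative A ->
  dissipative (adjoint A) ->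
  is_linear B ->
  continuous_on (fun t => 0 <= t) d ->
  0 < d0 ->
  0 < d1 ->
  (forall t, 0 <= t -> d0 <= d t <= d1) ->
  globally_exponentially_stable (damped A B d0) ->
  exists K beta : R, 0 < K /\ 0 < beta /\
    forall (v0 : H) (v : R -> H), mild_solution A B d v0 v ->
    forall t, 0 <= t -> norm (v t) <= K * exp (- beta * t) * norm v0.
Proof.
  intros k H U A B d d0 d1 _ Hdense _ Hdiss _ HB Hdc Hd0 Hd1 Hd
    [S [HS [K0 [beta0 [HK0 [Hbeta0 HSK]]]]]].
  destruct (linear_norm B HB) as [M [HM HBM]].
  destruct (restrict_generates H _ _ HS) as [HSs HSg].
  set (V := restrict_scalars H) in *.
  pose proof (real_ip_inner H) as Hq. fold V in Hq.
  assert (HM2 : 0 < M ^ 2) by now apply pow_lt.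
  destruct (damped_orbit_decay (V := V) (real_ip H) S (damping B) d0 d1 (M ^ 2) K0 beta0
    Hq HSs Hd0 Hd1 HM2 HK0 Hbeta0 HSK (damping_energy H U B M HB HBM))
    as [K [beta [HK [Hbeta Hdecay]]]].
  exists K, beta. split; [easy |]. split; [easy |].
  intros v0 v [T [HT [Hvc Hv]]] t Ht.
  destruct (restrict_generates H _ _ HT) as [HTs HTg].
  destruct (dissipative_contraction (V := V) (real_ip H) T (dom A) A
    (complete_norm_complete V) Hq HTs HTg (restrict_dense H A Hdense) Hdiss) as [HT1 Hinv].
  destruct (mild_damped_orbit A B d d0 d1 T v0 v HB Hdc Hd0 Hd1 Hd HTs HT1 Hvc Hv)
    as [<- Hu].
  apply (Hdecay T d v HTs HT1); try easy.
  (* The perturbation is [d0] times the damping, with bound [d0 * M ^ 2]: it is the difference of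
     the generators of [T] and [S] on their common domain. *)
  apply (perturbation (V := V) S K0 HSs (Rlt_le _ _ HK0)
    (fun t x Ht => stable_bound (V := V) S K0 beta0 HK0 Hbeta0 HSK t x Ht)
    T (dom A) A (fun x => @scal _ V d0 (damping B x)) (d0 * M ^ 2) HTs HT1 Hinv
    (restrict_dense H A Hdense)).
  - intros x Hx. now apply HTg.
  - intros x Hx. apply HSg. now split.
  - intros x y. rewrite (damping_minus H U B M HB HBM).
    set (px := damping B x : V). set (py := damping B y : V).
    change (scal d0 (minus px py) = minus (scal d0 px) (scal d0 py)). vec.
  - apply Rmult_le_pos; lra.
  - intros x. eapply Rle_trans; [right; apply (norm_scal_real (V := V)) |].
    rewrite Rabs_pos_eq, Rmult_assoc by lra.
    apply Rmult_le_compat_l; [lra |]. apply (damping_bound H U B M HB HM HBM).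
Qed.
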